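(* Let $p>1$ and let $\varphi(z)=az+b$ with $a,b\in\mathbb{C}$ and $0<|a|<1-|b|$. Then the spectrum of $D_\varphi$ acting on $S^p$ is $\{0\}$.
   Context: $\mathbb{D}$ is the open unit disk. For $p>1$, $H^p$ is the Hardy space on $\mathbb{D}$ with norm $\|g\|_{H^p}^p=\sup_{0<r<1}\int_0^{2\pi}|g(re^{i\theta})|^p\frac{d\theta}{2\pi}$; $S^p$ is the space of analytic $f$ on $\mathbb{D}$ with $f'\in H^p$, normed by $\|f\|_{S^p}=|f(0)|+\|f'\|_{H^p}$. $D_\varphi f=f'\circ\varphi$. *)

(* Defs.v *)
From Stdlib Require Import Reals.
From Coquelicot Require Import Coquelicot.
Open Scope R_scope.

Definition in_disk (z : C) : Prop := Cmod z < 1.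

Definition holo_disk (f : C -> C) : Prop :=
  forall z : C, in_disk z -> ex_derive (K := C_AbsRing) (V := C_NormedModule) f z.

Definition powr (x p : R) : R := if Req_EM_T x 0 then 0 else Rpower x p.

Definition polar (r t : R) : C := (r * cos t, r * sin t).

Definition circ_mean (p : R) (g : C -> C) (r : R) : R :=
  RInt (fun t => powr (Cmod (g (polar r t))) p) 0 (2 * PI) / (2 * PI).

Definition in_Hp (p : R) (g : C -> C) : Prop :=
  holo_disk g /\ exists M : R, forall r, 0 < r < 1 -> circ_mean p g r <= M.

Definition Hp_norm (p : R) (g : C -> C) : R :=
  powr (real (Lub_Rbar (fun y => exists r, 0 < r < 1 /\ y = circ_mean p g r))) (/ p).

Definition in_Sp (p : R) (f : C -> C) : Prop :=
  holo_disk f /\ in_Hp p (C_derive f).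

Definition Sp_norm (p : R) (f : C -> C) : R :=
  Cmod (f (RtoC 0)) + Hp_norm p (C_derive f).

Definition Dphi (phi : C -> C) (f : C -> C) : C -> C :=
  fun z => C_derive f (phi z).

(* T is a bounded linear operator on S^p (functions in S^p are identified
   when they agree on the disk) *)
Definition bounded_op_Sp (p : R) (T : (C -> C) -> (C -> C)) : Prop :=
  (forall f, in_Sp p f -> in_Sp p (T f)) /\
  (forall f g (c : C), in_Sp p f -> in_Sp p g ->
     forall z, in_disk z ->
       T (fun w => Cplus (Cmult c (f w)) (g w)) z = Cplus (Cmult c (T f z)) (T g z)) /\
  (forall f g, in_Sp p f -> in_Sp p g -> (forall z, in_disk z -> f z = g z) ->
     forall z, in_disk z -> T f z = T g z) /\
  (exists M : R, forall f, in_Sp p f -> Sp_norm p (T f) <= M * Sp_norm p f).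

Definition in_spectrum_Sp (p : R) (A : (C -> C) -> (C -> C)) (lam : C) : Prop :=
  ~ exists T : (C -> C) -> (C -> C),
      bounded_op_Sp p T /\
      forall f, in_Sp p f -> forall z, in_disk z ->
        T (fun w => Cminus (A f w) (Cmult lam (f w))) z = f z /\
        Cminus (A (T f) z) (Cmult lam (T f z)) = f z.

(* Main.v *)
(* Write A for the operator f |-> f' o phi. Since phi maps the disk into |z| <= |a| + |b| < 1,
   Cauchy's formula on a circle of radius r between |a| + |b| and 1 expresses
   A^(n+1) f = a^(n(n+1)/2) f^(n+1) o phi^(n+1) through the values of f' on that circle and bounds
   it, with any fixed number of derivatives, by |a|^(n(n+1)/2) times a factorial times the norm
   of f. Because |a| < 1, the Neumann series of (A - lambda)^-1 converges for every lambda <> 0.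
   On the other hand A kills the constants, so 0 is in the spectrum. *)

(* Cauchy's formula is proved for functions with a continuous derivative, by deforming the
   integrand. Membership in S^p makes f' differentiable, hence continuous; this brings first f and
   then f' within reach of the formula. The data on the circle enter the estimates only through the
   mean of their modulus, which the H^p norm controls up to a factor 2. Derivatives of integrals and
   of sums rest on one device: a remainder bounded by M |w - z|^2 uniformly on a disc. Such bounds
   can be integrated and summed, so the Cauchy transform and the Neumann series are differentiated
   with explicit constants. The majorants of that series have consecutive ratio L |a|^n (n + 6),
   which tends to 0. Its sum is formed pointwise, and lies in S^p because, apart from the multiple
   of f, its derivative is bounded on the disk. Functions are defined on all of C but matter only on
   the disk, so equality on the disk has to be carried through the iterates and their
   derivatives. *)
Require Import Defs.
From Stdlib Require Import Reals Lra Lia Factorial.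
From Coquelicot Require Import Coquelicot.
Open Scope R_scope.

(** * Complex differentiability and continuity *)

(* Equivalent to [is_derive] over [C_AbsRing] ([cder_is_derive]); stated with [Cmod] because
   Coquelicot's uniform structure on [C] is the product one. *)
Definition cder (f : C -> C) (z l : C) : Prop :=
  forall eps, 0 < eps -> exists d, 0 < d /\
    forall w, Cmod (w - z)%C < d ->
      Cmod (f w - f z - l * (w - z))%C <= eps * Cmod (w - z)%C.

(** The square of half-side d / sqrt 2 lies inside the disc of radius d, so squares and discs
    generate the same neighbourhoods. *)
Lemma locally_Cmod (z : C) (P : C -> Prop) :
  locally (T := C_UniformSpace) z P <->
  exists d, 0 < d /\ forall w, Cmod (w - z)%C < d -> P w.
Proof.
split.
- intros [d Hd]. exists d. split. apply cond_pos.
  intros w Hw. apply Hd. now apply C_NormedModule_mixin_compat1.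
- intros [d [Hd H]].
  assert (H2 : 0 < sqrt 2) by (apply sqrt_lt_R0; lra).
  assert (Hq : 0 < d / sqrt 2) by now apply Rdiv_lt_0_compat.
  exists (mkposreal _ Hq). intros w Hw. apply H.
  replace d with (sqrt 2 * (d / sqrt 2)) by (field; lra).
  exact (C_NormedModule_mixin_compat2 z w (mkposreal _ Hq) Hw).
Qed.

Lemma cder_is_derive (f : C -> C) (z l : C) :
  cder f z l <-> is_derive (K := C_AbsRing) (V := C_NormedModule) f z l.
Proof.
split.
- intros H. split. apply is_linear_scal_l.
  intros x Hx.
  apply (is_filter_lim_locally_unique (V := AbsRing_NormedModule C_AbsRing)) in Hx.
  subst x.
  intros eps. apply locally_C. apply locally_Cmod.
  destruct (H eps (cond_pos eps)) as [d [Hd Hf]].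
  exists d; split; trivial. intros w Hw.
  specialize (Hf w Hw).
  change (Cmod ((f w - f z) - (w - z) * l)%C <= eps * Cmod (w - z)%C).
  now rewrite (Cmult_comm (w - z)).
- intros [_ H] eps Heps.
  specialize (H z (fun P p => p) (mkposreal _ Heps)).
  apply locally_C in H. apply locally_Cmod in H.
  destruct H as [d [Hd Hf]]. exists d; split; trivial. intros w Hw.
  specialize (Hf w Hw).
  change (Cmod ((f w - f z) - (w - z) * l)%C <= eps * Cmod (w - z)%C) in Hf.
  now rewrite (Cmult_comm (w - z)) in Hf.
Qed.

Lemma cder_ex_derive (f : C -> C) (z l : C) :
  cder f z l -> ex_derive (K := C_AbsRing) (V := C_NormedModule) f z.
Proof. intros H. exists l. now apply cder_is_derive. Qed.

Lemma cder_C_derive (f : C -> C) (z l : C) : cder f z l -> C_derive f z = l.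
Proof. intros H. apply is_C_derive_unique. now apply cder_is_derive. Qed.

Lemma ex_derive_cder (f : C -> C) (z : C) :
  ex_derive (K := C_AbsRing) (V := C_NormedModule) f z -> cder f z (C_derive f z).
Proof. intros H. apply cder_is_derive. now apply C_derive_correct. Qed.

(** A derivative sees only nearby points. Both elements of S^p and Cauchy transforms are known only
    on a disc, so every change of representative passes through this. *)
Lemma cder_ext_disc (f g : C -> C) (R : R) (z l : C) :
  (forall w, Cmod w < R -> f w = g w) -> Cmod z < R -> cder f z l -> cder g z l.
Proof.
intros E Hz H eps Heps. destruct (H eps Heps) as [d [Hd Hf]].
exists (Rmin d (R - Cmod z)). split. apply Rmin_glb_lt; lra.
intros w Hw.
assert (Hw1 : Cmod (w - z)%C < d) by (eapply Rlt_le_trans; [apply Hw | apply Rmin_l]).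
assert (Hw2 : Cmod (w - z)%C < R - Cmod z) by (eapply Rlt_le_trans; [apply Hw | apply Rmin_r]).
rewrite <- !E; auto.
replace w with ((w - z) + z)%C by ring.
eapply Rle_lt_trans; [apply Cmod_triangle | lra].
Qed.

Lemma cder_lin (f g : C -> C) (c z l m : C) :
  cder f z l -> cder g z m -> cder (fun w => c * f w + g w)%C z (c * l + m)%C.
Proof.
intros Hf Hg eps Heps.
assert (Hc : 0 < Cmod c + 1) by (generalize (Cmod_ge_0 c); lra).
assert (He : 0 < eps / 2 / (Cmod c + 1)) by (apply Rdiv_lt_0_compat; lra).
destruct (Hf _ He) as [d1 [Hd1 H1]]. destruct (Hg (eps / 2)) as [d2 [Hd2 H2]]. lra.
exists (Rmin d1 d2). split. now apply Rmin_glb_lt. intros w Hw.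
specialize (H1 w (Rlt_le_trans _ _ _ Hw (Rmin_l _ _))).
specialize (H2 w (Rlt_le_trans _ _ _ Hw (Rmin_r _ _))).
replace (_ - _ - _)%C with (c * (f w - f z - l * (w - z)) + (g w - g z - m * (w - z)))%C by ring.
eapply Rle_trans; [apply Cmod_triangle |]. rewrite Cmod_mult.
apply Rle_trans with (Cmod c * (eps / 2 / (Cmod c + 1) * Cmod (w - z)%C) + eps / 2 * Cmod (w - z)%C).
apply Rplus_le_compat; trivial. apply Rmult_le_compat_l; trivial. apply Cmod_ge_0.
apply Rle_trans with ((Cmod c + 1) * (eps / 2 / (Cmod c + 1) * Cmod (w - z)%C) + eps / 2 * Cmod (w - z)%C).
apply Rplus_le_compat_r. apply Rmult_le_compat_r; [|lra].
apply Rmult_le_pos; [lra | apply Cmod_ge_0].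
right. field. lra.
Qed.

Lemma cder_const (c z : C) : cder (fun _ => c) z 0.
Proof.
intros eps Heps. exists 1. split. lra. intros w _.
replace (c - c - 0 * (w - z))%C with (RtoC 0) by ring. rewrite Cmod_0.
apply Rmult_le_pos. lra. apply Cmod_ge_0.
Qed.

Lemma cder_affine (f : C -> C) (u v z l : C) :
  cder f (u * z + v)%C l -> cder (fun w => f (u * w + v)%C) z (u * l)%C.
Proof.
intros H eps Heps.
assert (Hc : 0 < Cmod u + 1) by (generalize (Cmod_ge_0 u); lra).
destruct (H (eps / (Cmod u + 1))) as [d [Hd Hf]]. now apply Rdiv_lt_0_compat.
exists (d / (Cmod u + 1)). split. now apply Rdiv_lt_0_compat. intros w Hw.
assert (E : Cmod ((u * w + v) - (u * z + v))%C <= (Cmod u + 1) * Cmod (w - z)%C).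
{ replace ((u * w + v) - (u * z + v))%C with (u * (w - z))%C by ring.
  rewrite Cmod_mult. apply Rmult_le_compat_r. apply Cmod_ge_0. lra. }
eapply Rle_trans; [| eapply Rle_trans; [apply (Hf (u * w + v)%C) |]].
- right. f_equal. ring.
- eapply Rle_lt_trans; [apply E|].
  replace d with ((Cmod u + 1) * (d / (Cmod u + 1))) by (field; lra).
  now apply Rmult_lt_compat_l.
- eapply Rle_trans. apply Rmult_le_compat_l; [| apply E].
  left. now apply Rdiv_lt_0_compat. right. field. lra.
Qed.

(** Quadratic remainder bounds survive integration and summation, so derivatives of transforms and
    series are obtained in this form. *)
Lemma cder_sq (f : C -> C) (R M : R) (z l : C) :
  Cmod z < R ->
  (forall w, Cmod w < R -> Cmod (f w - f z - l * (w - z))%C <= M * Cmod (w - z)%C ^ 2) ->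
  cder f z l.
Proof.
intros Hz H eps Heps.
assert (HM : 0 < Rmax M 1) by (eapply Rlt_le_trans; [apply Rlt_0_1 | apply Rmax_r]).
exists (Rmin (R - Cmod z) (eps / Rmax M 1)). split.
apply Rmin_glb_lt. lra. now apply Rdiv_lt_0_compat.
intros w Hw.
assert (Hw1 : Cmod (w - z)%C < R - Cmod z) by (eapply Rlt_le_trans; [apply Hw | apply Rmin_l]).
assert (Hw2 : Cmod (w - z)%C < eps / Rmax M 1) by (eapply Rlt_le_trans; [apply Hw | apply Rmin_r]).
eapply Rle_trans; [apply H|].
replace w with ((w - z) + z)%C by ring.
eapply Rle_lt_trans; [apply Cmod_triangle | lra].
assert (H0 := Cmod_ge_0 (w - z)%C).
apply Rle_trans with (Rmax M 1 * Cmod (w - z)%C ^ 2).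
apply Rmult_le_compat_r. apply pow_le, H0. apply Rmax_l.
simpl. rewrite Rmult_1_r, <- Rmult_assoc. apply Rmult_le_compat_r; trivial.
apply Rle_trans with (Rmax M 1 * (eps / Rmax M 1)).
apply Rmult_le_compat_l; lra. right. field. lra.
Qed.

Lemma continuous_C (T : UniformSpace) (F : T -> C) (x : T) :
  continuous (U := C_UniformSpace) F x <->
  continuous (fun y => fst (F y)) x /\ continuous (fun y => snd (F y)) x.
Proof.
split.
- intros H. split.
  + apply (continuous_comp (V := C_UniformSpace) F fst); trivial.
    destruct (F x). apply (continuous_fst (U := R_UniformSpace) (V := R_UniformSpace)).
  + apply (continuous_comp (V := C_UniformSpace) F snd); trivial.
    destruct (F x). apply (continuous_snd (U := R_UniformSpace) (V := R_UniformSpace)).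
- intros [H1 H2] P [d Hd].
  assert (B1 := H1 _ (locally_ball (fst (F x)) d)).
  assert (B2 := H2 _ (locally_ball (snd (F x)) d)).
  unfold filtermap in *.
  generalize (filter_and _ _ B1 B2). apply filter_imp.
  intros y [Hy1 Hy2]. apply Hd. now split.
Qed.

Lemma cder_continuous (f : C -> C) (z l : C) :
  cder f z l -> continuous (T := C_UniformSpace) (U := C_UniformSpace) f z.
Proof.
intros H P HP. apply locally_Cmod in HP. destruct HP as [e [He HP]].
apply locally_Cmod.
destruct (H 1 Rlt_0_1) as [d [Hd Hf]].
assert (Hc : 0 < Cmod l + 1) by (generalize (Cmod_ge_0 l); lra).
exists (Rmin d (e / (Cmod l + 1))). split.
apply Rmin_glb_lt; trivial. now apply Rdiv_lt_0_compat.
intros w Hw. apply HP.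
assert (Hw1 : Cmod (w - z)%C < d) by (eapply Rlt_le_trans; [apply Hw | apply Rmin_l]).
assert (Hw2 : Cmod (w - z)%C < e / (Cmod l + 1)) by (eapply Rlt_le_trans; [apply Hw | apply Rmin_r]).
specialize (Hf w Hw1).
replace (f w - f z)%C with ((f w - f z - l * (w - z)) + l * (w - z))%C by ring.
eapply Rle_lt_trans; [apply Cmod_triangle|]. rewrite Cmod_mult.
apply Rle_lt_trans with ((Cmod l + 1) * Cmod (w - z)%C). lra.
replace e with ((Cmod l + 1) * (e / (Cmod l + 1))) by (field; lra).
now apply Rmult_lt_compat_l.
Qed.

Section ContinuousC.
Context {T : UniformSpace}.
Implicit Types F G : T -> C.

Lemma continuous_Cplus F G (x : T) :
  continuous (U := C_UniformSpace) F x -> continuous (U := C_UniformSpace) G x ->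
  continuous (U := C_UniformSpace) (fun y => F y + G y)%C x.
Proof.
intros HF HG. apply continuous_C in HF. apply continuous_C in HG. apply continuous_C.
split; simpl; apply (continuous_plus (V := R_NormedModule)); tauto.
Qed.

Lemma continuous_Cminus F G (x : T) :
  continuous (U := C_UniformSpace) F x -> continuous (U := C_UniformSpace) G x ->
  continuous (U := C_UniformSpace) (fun y => F y - G y)%C x.
Proof.
intros HF HG. apply continuous_C in HF. apply continuous_C in HG. apply continuous_C.
split; simpl; apply (continuous_minus (V := R_NormedModule)); tauto.
Qed.

Lemma continuous_Cmult F G (x : T) :
  continuous (U := C_UniformSpace) F x -> continuous (U := C_UniformSpace) G x ->
  continuous (U := C_UniformSpace) (fun y => F y * G y)%C x.
Proof.
intros HF HG. apply continuous_C in HF. apply continuous_C in HG. apply continuous_C.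
split; simpl.
apply (continuous_minus (V := R_NormedModule)); apply (continuous_mult (K := R_AbsRing)); tauto.
apply (continuous_plus (V := R_NormedModule)); apply (continuous_mult (K := R_AbsRing)); tauto.
Qed.

Lemma Cmod_sq_pos (z : C) : z <> RtoC 0 -> 0 < fst z ^ 2 + snd z ^ 2.
Proof.
intros H. apply Cmod_gt_0 in H. unfold Cmod in H.
apply sqrt_lt_0_alt. now rewrite sqrt_0.
Qed.

Lemma continuous_normsq F (x : T) :
  continuous (U := C_UniformSpace) F x ->
  continuous (fun y => fst (F y) ^ 2 + snd (F y) ^ 2) x.
Proof.
intros HF. apply continuous_C in HF.
assert (Hsq : forall u : T -> R, continuous u x -> continuous (fun y => u y ^ 2) x).
{ intros u Hu. apply (continuous_comp u (fun s => s ^ 2)); trivial.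
  apply (ex_derive_continuous (K := R_AbsRing) (V := R_NormedModule)).
  now auto_derive. }
apply (continuous_plus (V := R_NormedModule) (fun y => fst (F y) ^ 2) (fun y => snd (F y) ^ 2));
  apply Hsq; tauto.
Qed.

Lemma continuous_Cinv F (x : T) :
  continuous (U := C_UniformSpace) F x -> F x <> RtoC 0 ->
  continuous (U := C_UniformSpace) (fun y => / F y)%C x.
Proof.
intros HF H0. apply continuous_C in HF. apply continuous_C.
apply Cmod_sq_pos in H0.
assert (HN : continuous (fun y => / (fst (F y) ^ 2 + snd (F y) ^ 2)) x).
{ apply (continuous_comp (fun y => fst (F y) ^ 2 + snd (F y) ^ 2) Rinv).
  - now apply continuous_normsq, continuous_C.
  - apply continuous_Rinv. lra. }
split; simpl; apply (continuous_mult (K := R_AbsRing)); trivial; try tauto.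
apply (continuous_opp (V := R_NormedModule)); tauto.
Qed.

Lemma continuous_Cpow F n (x : T) :
  continuous (U := C_UniformSpace) F x ->
  continuous (U := C_UniformSpace) (fun y => F y ^ n)%C x.
Proof.
intros HF. induction n; simpl. apply continuous_const.
now apply continuous_Cmult.
Qed.

Lemma continuous_RtoC (u : T -> R) (x : T) :
  continuous u x -> continuous (U := C_UniformSpace) (fun y => RtoC (u y)) x.
Proof. intros H. apply continuous_C. split; simpl; trivial. apply continuous_const. Qed.

Lemma continuous_Cmod F (x : T) :
  continuous (U := C_UniformSpace) F x -> continuous (fun y => Cmod (F y)) x.
Proof.
intros HF.
apply (continuous_comp (fun y => fst (F y) ^ 2 + snd (F y) ^ 2) sqrt).
- now apply continuous_normsq.
- apply continuous_sqrt.
Qed.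

End ContinuousC.

Lemma continuous_polar {T : UniformSpace} (r : R) (u : T -> R) (x : T) :
  continuous u x -> continuous (U := C_UniformSpace) (fun y => polar r (u y)) x.
Proof.
intros H. apply continuous_C. split; simpl; apply (continuous_mult (K := R_AbsRing));
  try apply continuous_const.
apply (continuous_comp u cos); trivial. apply continuous_cos.
apply (continuous_comp u sin); trivial. apply continuous_sin.
Qed.

Lemma Cmod_polar (r t : R) : 0 <= r -> Cmod (polar r t) = r.
Proof.
intros Hr. unfold Cmod, polar. simpl fst; simpl snd.
replace ((r * cos t) ^ 2 + (r * sin t) ^ 2) with (r ^ 2 * ((sin t)² + (cos t)²))
  by (unfold Rsqr; ring).
rewrite sin2_cos2, Rmult_1_r. now apply sqrt_pow2.
Qed.

Lemma polar_2PI (r : R) : polar r (2 * PI) = polar r 0.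
Proof. unfold polar. now rewrite cos_2PI, sin_2PI, cos_0, sin_0. Qed.

(** * Complex-valued integrals over [0, 2 PI] *)

(** Taken by components, like [cint], so that the real theorems on [RInt] apply to each component;
    [rder_eps] gives the form in the modulus on which the chain rule relies. *)
Definition rder (h : R -> C) (t : R) (l : C) : Prop :=
  is_derive (fun s => fst (h s)) t (fst l) /\ is_derive (fun s => snd (h s)) t (snd l).

Lemma is_derive_eps (h : R -> R) (t l : R) :
  is_derive h t l <->
  forall eps, 0 < eps -> exists d, 0 < d /\ forall s, Rabs (s - t) < d ->
    Rabs (h s - h t - l * (s - t)) <= eps * Rabs (s - t).
Proof.
split.
- intros [_ H] eps Heps.
  destruct (H t (fun P p => p) (mkposreal _ Heps)) as [d Hd].
  exists d. split. apply cond_pos. intros s Hs.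
  specialize (Hd s Hs).
  change (Rabs ((h s - h t) - (s - t) * l) <= eps * Rabs (s - t)) in Hd.
  now rewrite (Rmult_comm (s - t)) in Hd.
- intros H. split. apply is_linear_scal_l.
  intros x Hx. apply (is_filter_lim_locally_unique (V := R_NormedModule)) in Hx. subst x.
  intros eps. destruct (H eps (cond_pos eps)) as [d [Hd Hf]].
  exists (mkposreal _ Hd). intros s Hs.
  specialize (Hf s Hs).
  change (Rabs ((h s - h t) - (s - t) * l) <= eps * Rabs (s - t)).
  now rewrite (Rmult_comm (s - t)).
Qed.

Lemma Cmod_le_Rabs (z : C) : Cmod z <= Rabs (fst z) + Rabs (snd z).
Proof.
destruct z as [x y]. simpl.
replace (x, y) with (RtoC x + Ci * RtoC y)%C
  by (apply injective_projections; simpl; ring).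
eapply Rle_trans; [apply Cmod_triangle|].
rewrite Cmod_mult, Cmod_Ci, !Cmod_R. lra.
Qed.

Lemma fst_le_Cmod (z : C) : Rabs (fst z) <= Cmod z.
Proof. eapply Rle_trans; [apply Rmax_l | apply Rmax_Cmod]. Qed.

Lemma snd_le_Cmod (z : C) : Rabs (snd z) <= Cmod z.
Proof. eapply Rle_trans; [apply Rmax_r | apply Rmax_Cmod]. Qed.

Lemma rder_eps (h : R -> C) (t : R) (l : C) :
  rder h t l <->
  forall eps, 0 < eps -> exists d, 0 < d /\ forall s, Rabs (s - t) < d ->
    Cmod (h s - h t - l * RtoC (s - t))%C <= eps * Rabs (s - t).
Proof.
split.
- intros [H1 H2] eps Heps.
  apply is_derive_eps with (eps := eps / 2) in H1; [|lra].
  apply is_derive_eps with (eps := eps / 2) in H2; [|lra].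
  destruct H1 as [d1 [Hd1 H1]]. destruct H2 as [d2 [Hd2 H2]].
  exists (Rmin d1 d2). split. now apply Rmin_glb_lt. intros s Hs.
  specialize (H1 s (Rlt_le_trans _ _ _ Hs (Rmin_l _ _))).
  specialize (H2 s (Rlt_le_trans _ _ _ Hs (Rmin_r _ _))).
  eapply Rle_trans; [apply Cmod_le_Rabs|].
  replace (fst (h s - h t - l * RtoC (s - t))%C)
    with (fst (h s) - fst (h t) - fst l * (s - t)) by (simpl; ring).
  replace (snd (h s - h t - l * RtoC (s - t))%C)
    with (snd (h s) - snd (h t) - snd l * (s - t)) by (simpl; ring).
  lra.
- intros H. split; apply is_derive_eps; intros eps Heps;
    destruct (H eps Heps) as [d [Hd Hf]]; exists d; split; trivial;
    intros s Hs; eapply Rle_trans; [| apply (Hf s Hs) | | apply (Hf s Hs)].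
  + replace (fst (h s) - fst (h t) - fst l * (s - t))
      with (fst (h s - h t - l * RtoC (s - t))%C) by (simpl; ring).
    apply fst_le_Cmod.
  + replace (snd (h s) - snd (h t) - snd l * (s - t))
      with (snd (h s - h t - l * RtoC (s - t))%C) by (simpl; ring).
    apply snd_le_Cmod.
Qed.

Lemma cder_rder (f : C -> C) (h : R -> C) (t : R) (l m : C) :
  cder f (h t) l -> rder h t m -> rder (fun s => f (h s)) t (l * m)%C.
Proof.
intros Hf Hh. apply rder_eps. rewrite rder_eps in Hh. intros eps Heps.
assert (Hm := Cmod_ge_0 m). assert (Hl := Cmod_ge_0 l).
destruct (Hf (eps / 2 / (Cmod m + 1))) as [d1 [Hd1 H1]].
  apply Rdiv_lt_0_compat; lra.
(* The bound 1 makes [h] Lipschitz at [t] with constant |m| + 1; the other bound pays for the inner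
   error after multiplication by [l]. *)
set (e2 := Rmin 1 (eps / 2 / (Cmod l + 1))).
assert (He2 : 0 < e2) by (apply Rmin_glb_lt; [lra | apply Rdiv_lt_0_compat; lra]).
destruct (Hh e2 He2) as [d2 [Hd2 H2]].
exists (Rmin d2 (d1 / (Cmod m + 1))). split.
  apply Rmin_glb_lt; trivial. apply Rdiv_lt_0_compat; lra.
intros s Hs.
assert (Hs1 := Rlt_le_trans _ _ _ Hs (Rmin_l _ _)).
assert (Hs2 := Rlt_le_trans _ _ _ Hs (Rmin_r _ _)).
specialize (H2 s Hs1).
assert (Ha := Rabs_pos (s - t)).
assert (E : Cmod (h s - h t)%C <= (Cmod m + 1) * Rabs (s - t)).
{ replace (h s - h t)%C with ((h s - h t - m * RtoC (s - t)) + m * RtoC (s - t))%C by ring.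
  eapply Rle_trans; [apply Cmod_triangle|]. rewrite Cmod_mult, Cmod_R.
  assert (e2 * Rabs (s - t) <= 1 * Rabs (s - t)).
  apply Rmult_le_compat_r; trivial. apply Rmin_l. lra. }
assert (E1 : Cmod (h s - h t)%C < d1).
{ eapply Rle_lt_trans; [apply E|].
  replace d1 with ((Cmod m + 1) * (d1 / (Cmod m + 1))) by (field; lra).
  apply Rmult_lt_compat_l; lra. }
specialize (H1 _ E1).
replace (f (h s) - f (h t) - l * m * RtoC (s - t))%C with
  ((f (h s) - f (h t) - l * (h s - h t)) + l * (h s - h t - m * RtoC (s - t)))%C by ring.
eapply Rle_trans; [apply Cmod_triangle|]. rewrite Cmod_mult.
replace eps with (eps / 2 / (Cmod m + 1) * (Cmod m + 1) + (Cmod l + 1) * (eps / 2 / (Cmod l + 1)))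
  by (field; lra).
rewrite Rmult_plus_distr_r. apply Rplus_le_compat.
- eapply Rle_trans; [apply H1|]. rewrite Rmult_assoc. apply Rmult_le_compat_l; trivial.
  left; apply Rdiv_lt_0_compat; lra.
- rewrite Rmult_assoc. apply Rmult_le_compat; trivial. apply Cmod_ge_0. lra.
  eapply Rle_trans; [apply H2|]. apply Rmult_le_compat_r; trivial. apply Rmin_r.
Qed.

Lemma rder_affine (h : R -> C) (c d : C) (t : R) (m : C) :
  rder h t m -> rder (fun s => c * h s + d)%C t (c * m)%C.
Proof.
intros H. apply (cder_rder (fun w => c * w + d)%C h); trivial.
intros eps Heps. exists 1. split. lra. intros w _.
replace (_ - _ - _)%C with (RtoC 0) by ring.
rewrite Cmod_0. apply Rmult_le_pos. lra. apply Cmod_ge_0.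
Qed.

Lemma rder_RtoC (t : R) : rder RtoC t 1.
Proof.
split; simpl.
- apply (is_derive_id (K := R_AbsRing)).
- apply (is_derive_const (K := R_AbsRing) (V := R_NormedModule)).
Qed.

Lemma rder_polar (r t : R) : rder (polar r) t (Ci * polar r t)%C.
Proof.
split; simpl.
- auto_derive; trivial. ring.
- auto_derive; trivial. ring.
Qed.

Lemma cder_inv (z : C) : z <> RtoC 0 -> cder (fun w => / w)%C z (- (/ z * / z))%C.
Proof.
intros Hz.
assert (Hm : 0 < Cmod z) by now apply Cmod_gt_0.
intros eps Heps.
(* The remainder is (w - z)^2 / (w z^2). Within |z| / 2 of z one has |w| > |z| / 2, so it is at most
   2 |w - z|^2 / |z|^3, whence the second bound. *)
exists (Rmin (Cmod z / 2) (eps * (Cmod z ^ 3 / 2))). split.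
  apply Rmin_glb_lt. lra. apply Rmult_lt_0_compat; trivial.
  apply Rdiv_lt_0_compat; [now apply pow_lt | lra].
intros w Hw.
assert (Hw1 := Rlt_le_trans _ _ _ Hw (Rmin_l _ _)).
assert (Hw2 := Rlt_le_trans _ _ _ Hw (Rmin_r _ _)).
assert (Hwm : Cmod z / 2 < Cmod w).
{ assert (H := Cmod_triangle w (z - w)%C). replace (w + (z - w))%C with z in H by ring.
  rewrite <- (Cmod_opp (z - w)%C) in H.
  replace (- (z - w))%C with (w - z)%C in H by ring. lra. }
assert (Hw0 : w <> RtoC 0) by (apply Cmod_gt_0; lra).
replace (/ w - / z - - (/ z * / z) * (w - z))%C
  with ((w - z) * (w - z) * (/ w * / z * / z))%C by (field; auto).
rewrite !Cmod_mult, !Cmod_inv; auto.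
assert (H0 := Cmod_ge_0 (w - z)%C).
rewrite (Rmult_comm eps), Rmult_assoc. apply Rmult_le_compat_l; trivial.
apply Rle_trans with ((eps * (Cmod z ^ 3 / 2)) * (/ (Cmod z / 2) * / Cmod z * / Cmod z)).
apply Rmult_le_compat; try lra.
- repeat apply Rmult_le_pos; left; apply Rinv_0_lt_compat; lra.
- repeat apply Rmult_le_compat_r; try (left; apply Rinv_0_lt_compat; lra).
  apply Rinv_le_contravar; lra.
- right. field. lra.
Qed.

Definition cint (F : R -> C) : C :=
  (RInt (fun t => fst (F t)) 0 (2 * PI), RInt (fun t => snd (F t)) 0 (2 * PI)).

Definition ccont (F : R -> C) : Prop := forall t, continuous (U := C_UniformSpace) F t.

Lemma ex_RInt_cont (f : R -> R) (a b : R) : (forall t, continuous f t) -> ex_RInt f a b.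
Proof. intros H. apply (ex_RInt_continuous (V := R_CompleteNormedModule)). auto. Qed.

Lemma ccont_fst F : ccont F -> forall t, continuous (fun t => fst (F t)) t.
Proof. intros H t. now apply (proj1 (continuous_C _ F t)). Qed.

Lemma ccont_snd F : ccont F -> forall t, continuous (fun t => snd (F t)) t.
Proof. intros H t. now apply (proj1 (continuous_C _ F t)). Qed.

Lemma cint_ext F G : (forall t, F t = G t) -> cint F = cint G.
Proof.
intros H. unfold cint. f_equal; apply RInt_ext; intros; now rewrite H.
Qed.

Lemma cint_unique F l :
  is_RInt (fun t => fst (F t)) 0 (2 * PI) (fst l) ->
  is_RInt (fun t => snd (F t)) 0 (2 * PI) (snd l) -> cint F = l.
Proof.
intros H1 H2. apply injective_projections; simpl;
  now apply (is_RInt_unique (V := R_CompleteNormedModule)).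
Qed.

Lemma cint_correct F : ccont F ->
  is_RInt (fun t => fst (F t)) 0 (2 * PI) (fst (cint F)) /\
  is_RInt (fun t => snd (F t)) 0 (2 * PI) (snd (cint F)).
Proof.
intros H. split; simpl; apply (RInt_correct (V := R_CompleteNormedModule));
  apply ex_RInt_cont. now apply ccont_fst. now apply ccont_snd.
Qed.

Lemma cint_lin F G (c : C) : ccont F -> ccont G ->
  cint (fun t => c * F t + G t)%C = (c * cint F + cint G)%C.
Proof.
intros HF HG. destruct (cint_correct F HF) as [F1 F2]. destruct (cint_correct G HG) as [G1 G2].
apply cint_unique.
- exact (is_RInt_plus (V := R_NormedModule) _ _ _ _ _ _
    (is_RInt_minus (V := R_NormedModule) _ _ _ _ _ _
      (is_RInt_scal (V := R_NormedModule) _ _ _ (fst c) _ F1)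
      (is_RInt_scal (V := R_NormedModule) _ _ _ (snd c) _ F2)) G1).
- exact (is_RInt_plus (V := R_NormedModule) _ _ _ _ _ _
    (is_RInt_plus (V := R_NormedModule) _ _ _ _ _ _
      (is_RInt_scal (V := R_NormedModule) _ _ _ (fst c) _ F2)
      (is_RInt_scal (V := R_NormedModule) _ _ _ (snd c) _ F1)) G2).
Qed.

Lemma is_RInt_cst (a b c l : R) : l = (b - a) * c -> is_RInt (fun _ => c) a b l.
Proof. intros ->. apply (is_RInt_const (V := R_NormedModule)). Qed.

Lemma cint_const (c : C) : cint (fun _ => c) = (RtoC (2 * PI) * c)%C.
Proof. apply cint_unique; apply is_RInt_cst; simpl; ring. Qed.

Lemma cint_scal F (c : C) : ccont F -> cint (fun t => c * F t)%C = (c * cint F)%C.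
Proof.
intros HF.
rewrite (cint_ext _ (fun t => c * F t + RtoC 0)%C) by (intros; ring).
rewrite (cint_lin F (fun _ => RtoC 0)); trivial.
rewrite cint_const. ring. intros t; apply continuous_const.
Qed.

Lemma cint_minus F G : ccont F -> ccont G ->
  cint (fun t => F t - G t)%C = (cint F - cint G)%C.
Proof.
intros HF HG.
rewrite (cint_ext _ (fun t => RtoC (-1) * G t + F t)%C).
2:{ intros t. apply injective_projections; simpl; ring. }
rewrite cint_lin by trivial.
apply injective_projections; simpl; ring.
Qed.

(** The norm inequality is applied to the pair as a vector of [C_R_NormedModule]; estimating the
    components separately would lose a constant. *)
Lemma cint_Cmod F g : ccont F -> (forall t, continuous g t) ->
  (forall t, Cmod (F t) <= g t) -> Cmod (cint F) <= RInt g 0 (2 * PI).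
Proof.
intros HF Hg H. destruct (cint_correct F HF) as [F1 F2].
change (cint F) with ((fst (cint F), snd (cint F)) : C).
rewrite Cmod_norm.
apply (norm_RInt_le (V := C_R_NormedModule) F g 0 (2 * PI)).
- generalize PI_RGT_0; lra.
- intros t _. specialize (H t). now rewrite Cmod_norm in H.
- now apply (is_RInt_fct_extend_pair (U := R_NormedModule) (V := R_NormedModule)).
- apply (RInt_correct (V := R_CompleteNormedModule)). now apply ex_RInt_cont.
Qed.

Lemma cint_ftc H F : (forall t, rder H t (F t)) -> ccont F ->
  cint F = (H (2 * PI)%R - H 0%R)%C.
Proof.
intros HD HF. apply cint_unique.
- apply (is_RInt_derive (V := R_CompleteNormedModule) (fun t => fst (H t))).
  intros t _. apply HD. intros t _. now apply ccont_fst.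
- apply (is_RInt_derive (V := R_CompleteNormedModule) (fun t => snd (H t))).
  intros t _. apply HD. intros t _. now apply ccont_snd.
Qed.

(** The integral of [h s] is differentiated under the integral sign, and its derivative is the
    integral of [k s]. The collar of width [eta] keeps a full neighbourhood of 0 and of 1 in the
    region of regularity. *)
Lemma RInt_homotopy (h k : R -> R -> R) (eta : R) :
  0 < eta ->
  (forall s t, - eta < s < 1 + eta -> is_derive (fun u => h u t) s (k s t)) ->
  (forall s t, - eta < s < 1 + eta ->
    continuous (T := prod_UniformSpace R_UniformSpace R_UniformSpace)
      (fun x : R * R => k (fst x) (snd x)) (s, t)) ->
  (forall s t, - eta < s < 1 + eta -> continuous (h s) t) ->
  (forall s, 0 < s < 1 -> RInt (k s) 0 (2 * PI) = 0) ->
  RInt (h 1) 0 (2 * PI) = RInt (h 0) 0 (2 * PI).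
Proof.
intros He Hd Hk Hh Hz.
assert (Hloc : forall s, - eta < s < 1 + eta ->
  locally s (fun u => - eta < u < 1 + eta)).
{ intros s Hs. apply (locally_interval _ s (Finite (- eta)) (Finite (1 + eta))); simpl; try lra.
  intros; lra. }
assert (D : forall s, - eta < s < 1 + eta ->
  is_derive (fun u => RInt (h u) 0 (2 * PI)) s (RInt (k s) 0 (2 * PI))).
{ intros s Hs.
  rewrite (RInt_ext (k s) (fun t => Derive (fun u => h u t) s)).
  2:{ intros t _. symmetry. apply is_derive_unique. auto. }
  apply (is_derive_RInt_param h 0 (2 * PI) s).
  - generalize (Hloc s Hs). apply filter_imp. intros u Hu t _. exists (k u t). auto.
  - intros t _. apply continuity_2d_pt_ext_loc with k.
    + destruct (Hloc s Hs) as [d Hl]. exists d. intros u v Hu _.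
      symmetry. apply is_derive_unique. apply Hd. now apply Hl.
    + apply continuity_2d_pt_filterlim. now apply Hk.
  - generalize (Hloc s Hs). apply filter_imp. intros u Hu.
    apply (ex_RInt_continuous (V := R_CompleteNormedModule)). auto. }
(* The derivative is known to vanish only for 0 < s < 1; at the endpoints the mean value theorem
   asks for continuity alone. *)
destruct (MVT_gen (fun u => RInt (h u) 0 (2 * PI)) 0 1 (fun _ => 0)) as [c [_ Hc]].
- intros s. rewrite Rmin_left, Rmax_right by lra. intros Hs.
  assert (Ds : - eta < s < 1 + eta) by lra.
  apply D in Ds. now rewrite (Hz s Hs) in Ds.
- intros s. rewrite Rmin_left, Rmax_right by lra. intros Hs.
  apply continuity_pt_filterlim. apply (ex_derive_continuous (K := R_AbsRing) (V := R_NormedModule)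
    (fun u => RInt (h u) 0 (2 * PI)) s).
  eexists. apply D. lra.
- lra.
Qed.

Lemma cint_homotopy (h k : R -> R -> C) (eta : R) :
  0 < eta ->
  (forall s t, - eta < s < 1 + eta -> rder (fun u => h u t) s (k s t)) ->
  (forall s t, - eta < s < 1 + eta ->
    continuous (T := prod_UniformSpace R_UniformSpace R_UniformSpace) (U := C_UniformSpace)
      (fun x : R * R => k (fst x) (snd x)) (s, t)) ->
  (forall s t, - eta < s < 1 + eta -> continuous (U := C_UniformSpace) (h s) t) ->
  (forall s, 0 < s < 1 -> cint (k s) = RtoC 0) ->
  cint (h 1) = cint (h 0).
Proof.
intros He Hd Hk Hh Hz. unfold cint. f_equal.
- apply (RInt_homotopy (fun s t => fst (h s t)) (fun s t => fst (k s t)) eta); trivial.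
  + intros s t Hs. now apply Hd.
  + intros s t Hs. now apply (proj1 (continuous_C _ _ _) (Hk s t Hs)).
  + intros s t Hs. now apply (proj1 (continuous_C _ _ _) (Hh s t Hs)).
  + intros s Hs. now injection (Hz s Hs).
- apply (RInt_homotopy (fun s t => snd (h s t)) (fun s t => snd (k s t)) eta); trivial.
  + intros s t Hs. now apply Hd.
  + intros s t Hs. now apply (proj1 (continuous_C _ _ _) (Hk s t Hs)).
  + intros s t Hs. now apply (proj1 (continuous_C _ _ _) (Hh s t Hs)).
  + intros s Hs. now injection (Hz s Hs).
Qed.

(** * Cauchy's integral formula *)

Lemma rder_ext (h g : R -> C) (t : R) (l m : C) :
  (forall s, h s = g s) -> l = m -> rder h t l -> rder g t m.
Proof.
intros E <- [H1 H2]. split; [apply is_derive_ext with (2 := H1) | apply is_derive_ext with (2 := H2)];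
  intros s; now rewrite E.
Qed.

(** * The Cauchy transform of a function on a circle *)

Definition cmean (F : R -> C) : R := RInt (fun t => Cmod (F t)) 0 (2 * PI) / (2 * PI).

(** This is n! / (2 pi i) times the integral of F / (zeta - z)^(n+1) d zeta over |zeta| = r: with
    zeta = [polar r t], d zeta = i zeta dt and the factor i cancels. [F] is any function of the
    angle, not necessarily the trace of a holomorphic one. *)
Definition cauchy_int (r : R) (F : R -> C) (n : nat) (z : C) : C :=
  (RtoC (INR (fact n) / (2 * PI)) *
   cint (fun t => F t * polar r t * (/ (polar r t - z)) ^ S n))%C.

Lemma Cmod_polar_minus (r t : R) (z : C) : 0 <= r -> r - Cmod z <= Cmod (polar r t - z)%C.
Proof.
intros Hr. assert (H := Cmod_triangle (polar r t - z)%C z).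
replace (polar r t - z + z)%C with (polar r t) in H by ring.
rewrite Cmod_polar in H; lra.
Qed.

Lemma polar_minus_neq0 (r t : R) (z : C) : Cmod z < r -> (polar r t - z)%C <> RtoC 0.
Proof.
intros H. apply Cmod_gt_0. assert (H0 := Cmod_ge_0 z).
assert (H1 := Cmod_polar_minus r t z). lra.
Qed.

Lemma Cmod_kernel (r rho t : R) (z : C) : rho < r -> Cmod z <= rho ->
  Cmod (/ (polar r t - z))%C <= / (r - rho).
Proof.
intros Hr Hz. assert (H0 := Cmod_ge_0 z).
rewrite Cmod_inv by (apply polar_minus_neq0; lra).
apply Rinv_le_contravar. lra.
assert (H1 := Cmod_polar_minus r t z). lra.
Qed.

Lemma ccont_kernel (r : R) (F : R -> C) (n : nat) (z : C) :
  ccont F -> Cmod z < r ->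
  ccont (fun t => F t * polar r t * (/ (polar r t - z)) ^ n)%C.
Proof.
intros HF Hz t. apply continuous_Cmult. apply continuous_Cmult. apply HF.
apply continuous_polar, continuous_id.
apply continuous_Cpow, continuous_Cinv. apply continuous_Cminus.
apply continuous_polar, continuous_id. apply continuous_const.
now apply polar_minus_neq0.
Qed.

(** Meant for u = 1 / (x - z'), v = 1 / (x - z) and d = z' - z, where u - v = d u v. The first-order
    variation of v^m is then m d v^(m+1). *)
Lemma Cpow_taylor (u v d : C) (B : R) (m : nat) :
  Cmod u <= B -> Cmod v <= B -> (u - v = d * u * v)%C ->
  Cmod (u ^ m - v ^ m - RtoC (INR m) * d * v ^ S m)%C <= INR m ^ 2 * B ^ (m + 2) * Cmod d ^ 2.
Proof.
intros Hu Hv E.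
assert (H0 := Cmod_ge_0 u). assert (H1 := Cmod_ge_0 v). assert (Hd := Cmod_ge_0 d).
assert (HB : 0 <= B) by lra.
induction m as [|m IH].
- simpl. replace (_ - _ - _)%C with (RtoC 0) by (apply injective_projections; simpl; ring).
  rewrite Cmod_0. lra.
(* The three summands contribute m^2, m and 1 times B^(m+3) |d|^2, and m^2 + m + 1 <= (m + 1)^2. *)
- replace (u ^ S m - v ^ S m - RtoC (INR (S m)) * d * v ^ S (S m))%C with
    (u * (u ^ m - v ^ m - RtoC (INR m) * d * v ^ S m)
     + RtoC (INR m) * d * v ^ S m * (d * u * v) + v ^ m * (d * d * u * v * v))%C.
  2:{ transitivity (u * (u ^ m - v ^ m - RtoC (INR m) * d * v ^ S m)
     + RtoC (INR m) * d * v ^ S m * (u - v) + v ^ m * ((u - v) - d * v * v))%C.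
      - rewrite E. replace (d * u * v - d * v * v)%C with (d * v * (u - v))%C by ring.
        rewrite E. ring.
      - rewrite S_INR, RtoC_plus. simpl. ring. }
  eapply Rle_trans; [apply Cmod_triangle|].
  eapply Rle_trans; [apply Rplus_le_compat_r, Cmod_triangle|].
  rewrite !Cmod_mult, !Cmod_pow, Cmod_R, (Rabs_right (INR m)) by (apply Rle_ge, pos_INR).
  assert (Hm := pos_INR m).
  assert (Hp : forall k, Cmod v ^ k <= B ^ k) by (intros k; now apply pow_incr).
  assert (Hq : forall k, 0 <= Cmod v ^ k) by (intros k; now apply pow_le).
  assert (HBk : forall k, 0 <= B ^ k) by (intros k; now apply pow_le).
  apply Rle_trans with (B * (INR m ^ 2 * B ^ (m + 2) * Cmod d ^ 2)
    + INR m * Cmod d * B ^ S m * (Cmod d * B * B) + B ^ m * (Cmod d * Cmod d * B * B * B)).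
  + apply Rplus_le_compat; [apply Rplus_le_compat|].
    * apply Rmult_le_compat; auto. apply Cmod_ge_0.
    * repeat apply Rmult_le_compat; try apply Rle_refl; auto; repeat apply Rmult_le_pos; auto.
    * repeat apply Rmult_le_compat; try apply Rle_refl; auto; repeat apply Rmult_le_pos; auto.
  + rewrite S_INR. replace (S m + 2)%nat with (3 + m)%nat by lia.
    replace (m + 2)%nat with (2 + m)%nat by lia. rewrite !pow_add. simpl (B ^ S m).
    assert (Hx : 0 <= B ^ m * (B * B * B) * (Cmod d * Cmod d)).
    { repeat apply Rmult_le_pos; auto. }
    assert (Hy : 0 <= INR m * (B ^ m * (B * B * B) * (Cmod d * Cmod d))) by now apply Rmult_le_pos.
    simpl. ring_simplify. ring_simplify in Hx. ring_simplify in Hy. lra.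
Qed.

Section Transform.
Variables (r rho : R) (F : R -> C).
Hypotheses (Hr : 0 < r <= 1) (Hrho : rho < r) (HF : ccont F).

Let PI2 : 0 < 2 * PI. Proof. generalize PI_RGT_0; lra. Qed.

Lemma cint_mean_bound (G : R -> C) (K : R) : ccont G ->
  (forall t, Cmod (G t) <= Cmod (F t) * K) -> Cmod (cint G) <= 2 * PI * (cmean F * K).
Proof.
intros HG H.
eapply Rle_trans; [apply (cint_Cmod G (fun t => K * Cmod (F t)))|]; trivial.
- intros t. apply (continuous_scal_r (K := R_AbsRing) (V := R_NormedModule) K).
  apply continuous_Cmod, HF.
- intros t. rewrite Rmult_comm. apply H.
- right. transitivity (K * RInt (fun t => Cmod (F t)) 0 (2 * PI)).
  + apply (RInt_scal (V := R_CompleteNormedModule)). apply ex_RInt_cont.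
    intros t. apply continuous_Cmod, HF.
  + unfold cmean. field. lra.
Qed.

Lemma cauchy_int_bound (n : nat) (z : C) : Cmod z <= rho ->
  Cmod (cauchy_int r F n z) <= INR (fact n) * (/ (r - rho)) ^ S n * cmean F.
Proof.
intros Hz. unfold cauchy_int. rewrite Cmod_mult, Cmod_R.
assert (Hn := pos_INR (fact n)).
rewrite Rabs_right by (apply Rle_ge, Rdiv_le_0_compat; trivial).
apply Rle_trans with (INR (fact n) / (2 * PI) * (2 * PI * (cmean F * (/ (r - rho)) ^ S n))).
2:{ right. field; repeat split; generalize PI_RGT_0; lra. }
apply Rmult_le_compat_l. apply Rdiv_le_0_compat; trivial.
apply cint_mean_bound. apply ccont_kernel; trivial. lra.
intros t. rewrite !Cmod_mult, Cmod_polar, Cmod_pow by lra.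
rewrite Rmult_assoc. apply Rmult_le_compat_l. apply Cmod_ge_0.
(* The factor |zeta| = r is bounded by 1 here. *)
rewrite <- (Rmult_1_l ((/ (r - rho)) ^ S n)). apply Rmult_le_compat; try lra.
apply pow_le, Cmod_ge_0. apply pow_incr. split. apply Cmod_ge_0.
now apply Cmod_kernel.
Qed.

(** The linear term of the kernel to the power n + 1 carries a factor n + 1, and (n + 1) n! = (n +
    1)! turns it into the transform of the next order. The constant is uniform in both points, as
    the later summation over iterates requires. *)
Lemma cauchy_int_taylor (n : nat) (z z' : C) : Cmod z <= rho -> Cmod z' <= rho ->
  Cmod (cauchy_int r F n z' - cauchy_int r F n z - cauchy_int r F (S n) z * (z' - z))%C <=
  INR (fact n) * (INR (S n) ^ 2 * (/ (r - rho)) ^ (n + 3)) * cmean F * Cmod (z' - z)%C ^ 2.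
Proof.
intros Hz Hz'.
assert (Kz : forall m, ccont (fun t => F t * polar r t * (/ (polar r t - z)) ^ m)%C).
{ intros m; apply ccont_kernel; trivial; lra. }
assert (Kz' : forall m, ccont (fun t => F t * polar r t * (/ (polar r t - z')) ^ m)%C).
{ intros m; apply ccont_kernel; trivial; lra. }
(* Factored for the pointwise estimate by [Cpow_taylor]; the expanded form in [HG0] is the one split
   by linearity of the integral. *)
set (G := fun t => (F t * polar r t * ((/ (polar r t - z')) ^ S n - (/ (polar r t - z)) ^ S n
  - RtoC (INR (S n)) * (z' - z) * (/ (polar r t - z)) ^ S (S n)))%C).
assert (HG0 : forall t, ((F t * polar r t * (/ (polar r t - z')) ^ S n -
     F t * polar r t * (/ (polar r t - z)) ^ S n) -
     (RtoC (INR (S n)) * (z' - z)) * (F t * polar r t * (/ (polar r t - z)) ^ S (S n)) = G t)%C).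
{ intros t. unfold G. ring. }
assert (HGc : ccont (fun t => ((F t * polar r t * (/ (polar r t - z')) ^ S n -
     F t * polar r t * (/ (polar r t - z)) ^ S n) -
     (RtoC (INR (S n)) * (z' - z)) * (F t * polar r t * (/ (polar r t - z)) ^ S (S n))))%C).
{ intros t. apply continuous_Cminus. apply continuous_Cminus. apply Kz'. apply Kz.
  apply continuous_Cmult. apply continuous_const. apply Kz. }
assert (E : (cauchy_int r F n z' - cauchy_int r F n z - cauchy_int r F (S n) z * (z' - z))%C =
  (RtoC (INR (fact n) / (2 * PI)) * cint (fun t => ((F t * polar r t * (/ (polar r t - z')) ^ S n -
     F t * polar r t * (/ (polar r t - z)) ^ S n) -
     (RtoC (INR (S n)) * (z' - z)) * (F t * polar r t * (/ (polar r t - z)) ^ S (S n)))))%C).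
{ rewrite cint_minus, cint_minus, cint_scal; auto.
  - unfold cauchy_int. rewrite fact_simpl, mult_INR.
    replace (INR (S n) * INR (fact n) / (2 * PI)) with (INR (S n) * (INR (fact n) / (2 * PI)))
      by (field; generalize PI_RGT_0; lra).
    rewrite RtoC_mult. ring.
  - intros t. apply continuous_Cminus. apply Kz'. apply Kz.
  - intros t. apply continuous_Cmult. apply continuous_const. apply Kz. }
rewrite E, Cmod_mult, Cmod_R.
assert (Hn := pos_INR (fact n)).
rewrite Rabs_right by (apply Rle_ge, Rdiv_le_0_compat; trivial).
apply Rle_trans with (INR (fact n) / (2 * PI) *
  (2 * PI * (cmean F * (INR (S n) ^ 2 * (/ (r - rho)) ^ (n + 3) * Cmod (z' - z)%C ^ 2)))).
2:{ right. field; repeat split; generalize PI_RGT_0; lra. }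
apply Rmult_le_compat_l. apply Rdiv_le_0_compat; trivial.
apply cint_mean_bound; trivial.
intros t. rewrite HG0. unfold G. rewrite !Cmod_mult, Cmod_polar by lra.
rewrite Rmult_assoc. apply Rmult_le_compat_l. apply Cmod_ge_0.
match goal with |- _ <= ?x => rewrite <- (Rmult_1_l x) end.
apply Rmult_le_compat; try lra. apply Cmod_ge_0.
replace (n + 3)%nat with (S n + 2)%nat by lia.
apply Cpow_taylor; try now apply Cmod_kernel.
assert (N1 : (polar r t - z)%C <> RtoC 0) by (apply polar_minus_neq0; lra).
assert (N2 : (polar r t - z')%C <> RtoC 0) by (apply polar_minus_neq0; lra).
field. auto.
Qed.

End Transform.

Lemma cder_cauchy_int (r : R) (F : R -> C) (n : nat) (z : C) :
  0 < r <= 1 -> ccont F -> Cmod z < r -> cder (cauchy_int r F n) z (cauchy_int r F (S n) z).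
Proof.
intros Hr HF Hz.
(* The radius halfway between |z| and r leaves a fixed gap to the circle, so that one constant
   serves all [w]. *)
apply cder_sq with (R := (Cmod z + r) / 2) (M := INR (fact n) *
  (INR (S n) ^ 2 * (/ (r - (Cmod z + r) / 2)) ^ (n + 3)) * cmean F). lra.
intros w Hw. apply cauchy_int_taylor; trivial; lra.
Qed.

(** Replace z by s z and let s run from 1 to 0, where the integrand is 1. The s-derivative zeta z /
    (zeta - s z)^2 is the angular derivative of i z / (zeta - s z), which is periodic, so its
    integral vanishes. *)
Lemma cint_kernel (r : R) (z : C) : 0 < r -> Cmod z < r ->
  cint (fun t => polar r t * / (polar r t - z))%C = RtoC (2 * PI).
Proof.
intros Hr Hz. assert (Hz0 := Cmod_ge_0 z).
(* The collar is chosen so that |s z| is at most |z| + (r - |z|) / 2, still below r. *)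
assert (Hin : forall s, - ((r - Cmod z) / (2 * r)) < s < 1 + (r - Cmod z) / (2 * r) ->
  Cmod (RtoC s * z)%C < r).
{ intros s Hs. rewrite Cmod_mult, Cmod_R.
  apply Rle_lt_trans with ((1 + (r - Cmod z) / (2 * r)) * Cmod z).
  apply Rmult_le_compat_r; trivial. apply Rabs_le. lra.
  apply Rle_lt_trans with (Cmod z + (r - Cmod z) / (2 * r) * r).
  2:{ replace ((r - Cmod z) / (2 * r) * r) with ((r - Cmod z) / 2) by (field; lra). lra. }
  rewrite Rmult_plus_distr_r, Rmult_1_l. apply Rplus_le_compat_l, Rmult_le_compat_l; try lra.
  apply Rdiv_le_0_compat; lra. }
set (h := fun s t => (polar r t * / (polar r t - RtoC s * z))%C).
set (k := fun s t => (polar r t * z * (/ (polar r t - RtoC s * z) * / (polar r t - RtoC s * z)))%C).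
assert (cont_in : forall (T : UniformSpace) (u v : T -> R) x,
  Cmod (RtoC (u x) * z)%C < r -> continuous u x -> continuous v x ->
  continuous (U := C_UniformSpace) (fun y => / (polar r (v y) - RtoC (u y) * z))%C x).
{ intros T u v x Hx Hu Hv. apply continuous_Cinv. apply continuous_Cminus.
  now apply continuous_polar. apply continuous_Cmult. now apply continuous_RtoC.
  apply continuous_const. now apply polar_minus_neq0. }
transitivity (cint (h 1)).
{ apply cint_ext. intros t. unfold h. now replace (RtoC 1 * z)%C with z by ring. }
rewrite (cint_homotopy h k ((r - Cmod z) / (2 * r))).
- transitivity (cint (fun _ => RtoC 1)).
  + apply cint_ext. intros t. unfold h.
    replace (polar r t - RtoC 0 * z)%C with (polar r t) by ring.
    apply Cinv_r. apply Cmod_gt_0. rewrite Cmod_polar; lra.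
  + rewrite cint_const. ring.
- apply Rdiv_lt_0_compat; lra.
- intros s t Hs. specialize (Hin s Hs).
  assert (N := polar_minus_neq0 r t _ Hin).
  assert (H1 := rder_affine RtoC (- z)%C (polar r t) s _ (rder_RtoC s)).
  assert (H2 := cder_inv _ N).
  replace (polar r t - RtoC s * z)%C with (- z * RtoC s + polar r t)%C in H2 by ring.
  assert (H3 := rder_affine _ (polar r t) (RtoC 0) s _ (cder_rder _ (fun s => - z * RtoC s + polar r t)%C s _ _ H2 H1)).
  refine (rder_ext _ _ _ _ _ _ _ H3).
  + intros u. unfold h. rewrite Cplus_0_r. do 2 f_equal. ring.
  + unfold k. replace (- z * RtoC s + polar r t)%C with (polar r t - RtoC s * z)%C by ring. ring.
- intros s t Hs. specialize (Hin s Hs). unfold k.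
  assert (c1 : continuous (T := prod_UniformSpace R_UniformSpace R_UniformSpace) fst (s, t)) by apply continuous_fst.
  assert (c2 : continuous (T := prod_UniformSpace R_UniformSpace R_UniformSpace) snd (s, t)) by apply continuous_snd.
  apply continuous_Cmult. apply continuous_Cmult. now apply continuous_polar. apply continuous_const.
  apply continuous_Cmult; now apply cont_in.
- intros s t Hs. specialize (Hin s Hs). unfold h. apply continuous_Cmult.
  apply continuous_polar, continuous_id.
  apply (cont_in _ (fun _ => s) (fun t => t)); trivial. apply continuous_const. apply continuous_id.
- intros s Hs. assert (Hi : Cmod (RtoC s * z)%C < r).
  { apply Hin. assert (0 < (r - Cmod z) / (2 * r)) by (apply Rdiv_lt_0_compat; lra). lra. }
  assert (HD : forall t, rder (fun t => Ci * z * / (polar r t - RtoC s * z))%C t (k s t)).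
  { intros t. assert (N := polar_minus_neq0 r t _ Hi).
    assert (H1 := rder_affine (polar r) (RtoC 1) (- RtoC s * z)%C t _ (rder_polar r t)).
    assert (H2 := cder_inv _ N).
    replace (polar r t - RtoC s * z)%C with (RtoC 1 * polar r t + - RtoC s * z)%C in H2 by ring.
    assert (H3 := rder_affine _ (Ci * z)%C (RtoC 0) t _
      (cder_rder _ (fun t => RtoC 1 * polar r t + - RtoC s * z)%C t _ _ H2 H1)).
    refine (rder_ext _ _ _ _ _ _ _ H3).
    + intros u. rewrite Cplus_0_r. do 2 f_equal. ring.
    + unfold k. replace (RtoC 1 * polar r t + - RtoC s * z)%C with (polar r t - RtoC s * z)%C by ring.
      generalize (/ (polar r t - RtoC s * z))%C. intros q.
      replace (Ci * z * (- (q * q) * (RtoC 1 * (Ci * polar r t))))%C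
        with (- (Ci * Ci) * (polar r t * z * (q * q)))%C by ring.
      replace (Ci * Ci)%C with (- RtoC 1)%C by (apply injective_projections; simpl; ring).
      ring. }
  rewrite (cint_ftc _ _ HD).
  + rewrite polar_2PI. ring.
  + intros t. unfold k. apply continuous_Cmult. apply continuous_Cmult.
    apply continuous_polar, continuous_id. apply continuous_const.
    apply continuous_Cmult; apply (cont_in _ (fun _ => s) (fun t => t)); trivial;
      try apply continuous_const; apply continuous_id.
Qed.

(* The integral of [f (z + s (w - z)) w / (w - z)] over [|w| = r] does not depend on [s]: its
   [s]-derivative [f' (z + s (w - z)) w] is, up to the factor [s i], a derivative in the angle. *)
Lemma cauchy_formula (f f' : C -> C) (R r : R) (z : C) :
  (forall w, Cmod w < R -> cder f w (f' w)) ->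
  (forall w, Cmod w < R -> continuous (T := C_UniformSpace) (U := C_UniformSpace) f' w) ->
  0 < r < R -> Cmod z < r ->
  cauchy_int r (fun t => f (polar r t)) 0 z = f z.
Proof.
intros Hf Hf' Hr Hz. assert (Hz0 := Cmod_ge_0 z).
(* The point (1 - s) z + s zeta has modulus at most (|1 - s| + |s|) r <= (1 + 2 eta) r = (R + r) /
   2. *)
set (eta := (R - r) / (4 * r)).
assert (He : 0 < eta) by (apply Rdiv_lt_0_compat; lra).
assert (Hin : forall s t, - eta < s < 1 + eta -> Cmod (z + RtoC s * (polar r t - z))%C < R).
{ intros s t Hs.
  replace (z + RtoC s * (polar r t - z))%C with (RtoC (1 - s) * z + RtoC s * polar r t)%C
    by (rewrite RtoC_minus; ring).
  eapply Rle_lt_trans; [apply Cmod_triangle|]. rewrite !Cmod_mult, !Cmod_R, Cmod_polar by lra.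
  apply Rle_lt_trans with ((Rabs (1 - s) + Rabs s) * r).
  - rewrite Rmult_plus_distr_r. apply Rplus_le_compat_r, Rmult_le_compat_l. apply Rabs_pos. lra.
  - apply Rle_lt_trans with ((1 + 2 * eta) * r).
    + apply Rmult_le_compat_r. lra. unfold Rabs; destruct (Rcase_abs _), (Rcase_abs _); lra.
    + unfold eta. replace ((1 + 2 * ((R - r) / (4 * r))) * r) with (r + (R - r) / 2) by (field; lra). lra. }
assert (N : forall t, (polar r t - z)%C <> RtoC 0) by (intros; now apply polar_minus_neq0).
set (h := fun s t => (f (z + RtoC s * (polar r t - z)) * (polar r t * / (polar r t - z)))%C).
set (k := fun s t => (f' (z + RtoC s * (polar r t - z)) * polar r t)%C).
assert (cont_in : forall (T : UniformSpace) (g : C -> C) (u v : T -> Rdefinitions.R) x,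
  continuous (T := C_UniformSpace) (U := C_UniformSpace) g (z + RtoC (u x) * (polar r (v x) - z))%C ->
  continuous u x -> continuous v x ->
  continuous (U := C_UniformSpace) (fun y => g (z + RtoC (u y) * (polar r (v y) - z)))%C x).
{ intros T g u v x Hx Hu Hv.
  apply (continuous_comp (V := C_UniformSpace) (W := C_UniformSpace)
    (fun y => z + RtoC (u y) * (polar r (v y) - z))%C g); trivial.
  apply continuous_Cplus. apply continuous_const. apply continuous_Cmult.
  now apply continuous_RtoC. apply continuous_Cminus. now apply continuous_polar. apply continuous_const. }
assert (E : cint (fun t => f (polar r t) * polar r t * (/ (polar r t - z)) ^ 1)%C = cint (h 1)).
{ apply cint_ext. intros t. unfold h.
  replace (z + RtoC 1 * (polar r t - z))%C with (polar r t) by ring. simpl. ring. }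
unfold cauchy_int. rewrite E.
rewrite (cint_homotopy h k eta); trivial.
- transitivity (RtoC (INR (fact 0) / (2 * PI)) * (f z * RtoC (2 * PI)))%C.
  + f_equal. rewrite <- (cint_kernel r z) by lra. rewrite <- cint_scal.
    * apply cint_ext. intros t. unfold h. now replace (z + RtoC 0 * (polar r t - z))%C with z by ring.
    * intros t. apply continuous_Cmult. apply continuous_polar, continuous_id.
      apply continuous_Cinv; trivial. apply continuous_Cminus. apply continuous_polar, continuous_id.
      apply continuous_const.
  + rewrite (Cmult_comm (f z)), Cmult_assoc, <- RtoC_mult.
    replace (INR (fact 0) / (2 * PI) * (2 * PI))%R with 1%R. ring.
    simpl. field. generalize PI_RGT_0; lra.
- intros s t Hs.
  assert (H1 := rder_affine RtoC (polar r t - z)%C z s _ (rder_RtoC s)).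
  assert (H2 := Hf _ (Hin s t Hs)).
  replace (z + RtoC s * (polar r t - z))%C with ((polar r t - z) * RtoC s + z)%C in H2 by ring.
  assert (H3 := rder_affine _ (polar r t * / (polar r t - z))%C (RtoC 0) s _
    (cder_rder _ (fun s => (polar r t - z) * RtoC s + z)%C s _ _ H2 H1)).
  refine (rder_ext _ _ _ _ _ _ _ H3).
  + intros u. unfold h. rewrite Cplus_0_r, Cmult_comm. do 2 f_equal. ring.
  + unfold k. replace ((polar r t - z) * RtoC s + z)%C with (z + RtoC s * (polar r t - z))%C by ring.
    field. apply N.
- intros s t Hs. unfold k.
  assert (c1 : continuous (T := prod_UniformSpace R_UniformSpace R_UniformSpace) fst (s, t)) by apply continuous_fst.
  assert (c2 : continuous (T := prod_UniformSpace R_UniformSpace R_UniformSpace) snd (s, t)) by apply continuous_snd.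
  apply continuous_Cmult. 2: now apply continuous_polar.
  apply cont_in; trivial. apply Hf'. now apply Hin.
- intros s t Hs. unfold h. apply continuous_Cmult.
  + apply (cont_in _ f (fun _ => s) (fun t => t)); [|apply continuous_const|apply continuous_id].
    eapply cder_continuous. apply Hf. now apply Hin.
  + apply continuous_Cmult. apply continuous_polar, continuous_id.
    apply continuous_Cinv; trivial. apply continuous_Cminus. apply continuous_polar, continuous_id.
    apply continuous_const.
- intros s Hs. assert (Hs' : - eta < s < 1 + eta) by lra.
  assert (Hk : ccont (k s)).
  { intros t. unfold k. apply continuous_Cmult. 2: apply continuous_polar, continuous_id.
    apply (cont_in _ f' (fun _ => s) (fun t => t)); [|apply continuous_const|apply continuous_id].
    apply Hf'. now apply Hin. }
  assert (HD : forall t, rder (fun t => f (z + RtoC s * (polar r t - z)))%C t (RtoC s * Ci * k s t)%C).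
  { intros t.
    assert (H1 := rder_affine (polar r) (RtoC s) (z - RtoC s * z)%C t _ (rder_polar r t)).
    assert (H2 := Hf _ (Hin s t Hs')).
    replace (z + RtoC s * (polar r t - z))%C with (RtoC s * polar r t + (z - RtoC s * z))%C in H2 by ring.
    assert (H3 := cder_rder _ (fun t => RtoC s * polar r t + (z - RtoC s * z))%C t _ _ H2 H1).
    refine (rder_ext _ _ _ _ _ _ _ H3).
    + intros u. f_equal. ring.
    + unfold k. replace (RtoC s * polar r t + (z - RtoC s * z))%C with (z + RtoC s * (polar r t - z))%C by ring.
      ring. }
  assert (H0 : (RtoC s * Ci * cint (k s))%C = RtoC 0).
  { rewrite <- cint_scal by trivial. rewrite (cint_ftc _ _ HD).
    - rewrite polar_2PI. ring.
    - intros t. apply continuous_Cmult. apply continuous_const. apply Hk. }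
  (* The factor s i is divided out, which is possible because s > 0; at s = 0 the argument would
     break down. *)
  replace (cint (k s)) with (- (Ci * RtoC (/ s)) * (RtoC s * Ci * cint (k s)))%C.
  + rewrite H0. ring.
  + replace (- (Ci * RtoC (/ s)) * (RtoC s * Ci * cint (k s)))%C
      with (- (Ci * Ci) * (RtoC (/ s) * RtoC s) * cint (k s))%C by ring.
    rewrite <- RtoC_mult, Rinv_l by lra.
    replace (Ci * Ci)%C with (- RtoC 1)%C by (apply injective_projections; simpl; ring).
    ring.
Qed.

(** * Hardy norms *)

Lemma powr_pos (x p : R) : 0 < x -> powr x p = Rpower x p.
Proof. intros H. unfold powr. destruct (Req_EM_T x 0); trivial. lra. Qed.

Lemma powr_0 (p : R) : powr 0 p = 0.
Proof. unfold powr. destruct (Req_EM_T 0 0); lra. Qed.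

Lemma powr_ge_0 (x p : R) : 0 <= powr x p.
Proof. unfold powr. destruct (Req_EM_T x 0). lra. left. apply exp_pos. Qed.

Lemma powr_gt_0 (x p : R) : 0 < x -> 0 < powr x p.
Proof. intros H. rewrite powr_pos by trivial. apply exp_pos. Qed.

Lemma powr_le (x y p : R) : 0 <= p -> 0 <= x <= y -> powr x p <= powr y p.
Proof.
intros Hp Hx. destruct (Rle_lt_or_eq_dec 0 x (proj1 Hx)) as [H | <-].
- rewrite !powr_pos by lra. now apply Rle_Rpower_l.
- rewrite powr_0. apply powr_ge_0.
Qed.

Lemma powr_mult (x y p : R) : 0 <= x -> 0 <= y -> powr (x * y) p = powr x p * powr y p.
Proof.
intros Hx Hy. destruct (Rle_lt_or_eq_dec 0 x Hx) as [H | <-].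
2: now rewrite Rmult_0_l, powr_0, Rmult_0_l.
destruct (Rle_lt_or_eq_dec 0 y Hy) as [H' | <-].
2: now rewrite Rmult_0_r, powr_0, Rmult_0_r.
rewrite !powr_pos; trivial. now apply eq_sym, Rpower_mult_distr.
now apply Rmult_lt_0_compat.
Qed.

Lemma powr_powr (x p q : R) : 0 <= x -> p * q = 1 -> powr (powr x p) q = x.
Proof.
intros Hx E. destruct (Rle_lt_or_eq_dec 0 x Hx) as [H | <-].
- rewrite (powr_pos x), powr_pos by (trivial; apply exp_pos).
  rewrite Rpower_mult, E. now apply Rpower_1.
- now rewrite !powr_0.
Qed.

Lemma powr_ge_self (y p : R) : 1 <= p -> 1 <= y -> y <= powr y p.
Proof.
intros Hp Hy. rewrite powr_pos by lra. rewrite <- (Rpower_1 y) at 1 by lra.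
now apply Rle_Rpower.
Qed.

(** The sum is at most twice the larger of the two, whose p-th power is one of the summands on the
    right. *)
Lemma powr_plus_le (x y p : R) : 0 <= p -> 0 <= x -> 0 <= y ->
  powr (x + y) p <= powr 2 p * (powr x p + powr y p).
Proof.
intros Hp Hx Hy. assert (H2 := powr_ge_0 2 p).
assert (H3 := powr_ge_0 x p). assert (H4 := powr_ge_0 y p).
destruct (Rle_dec x y).
- apply Rle_trans with (powr (2 * y) p). apply powr_le; lra.
  rewrite powr_mult by lra. apply Rmult_le_compat_l; lra.
- apply Rle_trans with (powr (2 * x) p). apply powr_le; lra.
  rewrite powr_mult by lra. apply Rmult_le_compat_l; lra.
Qed.

Lemma continuous_powr {T : UniformSpace} (u : T -> R) (p : R) (x : T) :
  0 < p -> (forall y, 0 <= u y) -> continuous u x -> continuous (fun y => powr (u y) p) x.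
Proof.
intros Hp Hu Hc.
destruct (Rle_lt_or_eq_dec 0 (u x) (Hu x)) as [H | H].
- apply (continuous_ext_loc _ (fun y => Rpower (u y) p)).
  + assert (HP : locally (u x) (fun v => 0 < v)) by now apply (open_gt 0).
    generalize (Hc _ HP). unfold filtermap. apply filter_imp. intros y Hy. now rewrite powr_pos.
  + apply (continuous_comp (fun y => p * ln (u y)) exp).
    * apply (continuous_mult (K := R_AbsRing)). apply continuous_const.
      apply (continuous_comp u ln); trivial. now apply continuous_ln.
    * apply continuous_exp.
- intros P HP. rewrite <- H, powr_0 in HP. destruct HP as [e He].
  set (d := powr e (/ p)).
  assert (Hd : 0 < d) by (apply powr_gt_0, cond_pos).
  assert (HB := Hc _ (locally_ball (u x) (mkposreal _ Hd))).
  generalize HB. unfold filtermap. apply filter_imp. intros y Hy. apply He.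
  assert (Hy' : u y < d).
  { change (Rabs (u y - u x) < d) in Hy. rewrite <- H, Rminus_0_r, Rabs_right in Hy; trivial.
    apply Rle_ge, Hu. }
  change (Rabs (powr (u y) p - 0) < e).
  rewrite Rminus_0_r, Rabs_right by (apply Rle_ge, powr_ge_0).
  destruct (Rle_lt_or_eq_dec 0 (u y) (Hu y)) as [H' | <-].
  2: rewrite powr_0; apply cond_pos.
  rewrite powr_pos by trivial.
  apply Rlt_le_trans with (powr d p).
  + rewrite powr_pos by trivial. apply Rlt_Rpower_l; lra.
  + right. unfold d. apply powr_powr. left; apply cond_pos. field. lra.
Qed.

Section Hardy.
Variable p : R.
Hypothesis Hp : 1 < p.

Let PI2 : 0 < 2 * PI. Proof. generalize PI_RGT_0; lra. Qed.
Let p0 : 0 < p. Proof. lra. Qed.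

Lemma holo_cder (g : C -> C) (z : C) : holo_disk g -> in_disk z -> cder g z (C_derive g z).
Proof. intros Hg Hz. now apply ex_derive_cder, Hg. Qed.

Lemma in_disk_polar (r t : R) : 0 < r < 1 -> in_disk (polar r t).
Proof. intros H. unfold in_disk. rewrite Cmod_polar; lra. Qed.

Lemma ccont_circle (g : C -> C) (r : R) : holo_disk g -> 0 < r < 1 ->
  ccont (fun t => g (polar r t)).
Proof.
intros Hg Hr t.
apply (continuous_comp (V := C_UniformSpace) (W := C_UniformSpace) (polar r) g).
apply continuous_polar, continuous_id.
eapply cder_continuous. apply holo_cder; trivial. now apply in_disk_polar.
Qed.

Lemma continuous_powr_circle (g : C -> C) (r : R) : holo_disk g -> 0 < r < 1 ->
  forall t, continuous (fun t => powr (Cmod (g (polar r t))) p) t.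
Proof.
intros Hg Hr t. apply continuous_powr; trivial. intros; apply Cmod_ge_0.
now apply continuous_Cmod, (ccont_circle g r).
Qed.

(** Every comparison of circular means below is an instance: B = 0 for bounded functions, A = 0 for
    sums, both positive for comparing the mean of the modulus with the p-th mean. *)
Lemma RInt_mean_le (u : R -> R) (A B m : R) : (forall t, continuous u t) ->
  forall v : R -> R, (forall t, continuous v t) -> 0 <= B ->
  (forall t, u t <= A + B * v t) -> RInt v 0 (2 * PI) / (2 * PI) <= m ->
  RInt u 0 (2 * PI) / (2 * PI) <= A + B * m.
Proof.
intros Hu v Hv HB H Hm.
assert (I : is_RInt (fun t => A + B * v t) 0 (2 * PI) (A * (2 * PI) + B * RInt v 0 (2 * PI))).
{ apply (is_RInt_plus (V := R_NormedModule) (fun _ => A) (fun t => B * v t)).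
  apply is_RInt_cst; ring.
  apply (is_RInt_scal (V := R_NormedModule) v).
  apply (RInt_correct (V := R_CompleteNormedModule)). now apply ex_RInt_cont. }
apply Rle_trans with ((A * (2 * PI) + B * RInt v 0 (2 * PI)) / (2 * PI)).
- apply Rmult_le_compat_r. left; now apply Rinv_0_lt_compat.
  rewrite <- (is_RInt_unique (V := R_CompleteNormedModule) _ _ _ _ I).
  apply RInt_le. lra. now apply ex_RInt_cont. eexists; apply I. auto.
- replace ((A * (2 * PI) + B * RInt v 0 (2 * PI)) / (2 * PI))
    with (A + B * (RInt v 0 (2 * PI) / (2 * PI))) by (field; generalize PI_RGT_0; lra).
  apply Rplus_le_compat_l. now apply Rmult_le_compat_l.
Qed.

Lemma circ_mean_ge_0 (g : C -> C) (r : R) : holo_disk g -> 0 < r < 1 -> 0 <= circ_mean p g r.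
Proof.
intros Hg Hr. apply Rdiv_le_0_compat; trivial. apply RInt_ge_0. lra.
apply ex_RInt_cont. now apply continuous_powr_circle. intros; apply powr_ge_0.
Qed.

Lemma circ_mean_bounded (g : C -> C) (r m : R) : holo_disk g -> 0 < r < 1 ->
  (forall z, in_disk z -> Cmod (g z) <= m) -> circ_mean p g r <= powr m p.
Proof.
intros Hg Hr H. rewrite <- (Rplus_0_r (powr m p)), <- (Rmult_0_l 0).
apply (RInt_mean_le _ (powr m p) 0 0) with (v := fun _ => 0).
- now apply continuous_powr_circle.
- intros; apply continuous_const.
- lra.
- intros t. rewrite Rmult_0_l, Rplus_0_r. apply powr_le. lra. split. apply Cmod_ge_0.
  now apply H, in_disk_polar.
- rewrite (is_RInt_unique (V := R_CompleteNormedModule) _ _ _ 0). lra.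
  apply is_RInt_cst; ring.
Qed.

Definition mean_set (g : C -> C) : R -> Prop :=
  fun y => exists r, 0 < r < 1 /\ y = circ_mean p g r.

(** [real] sends infinite values to 0, so finiteness must be established before the norm means
    anything: [M] excludes plus infinity, and the nonnegative mean at radius 1/2 excludes minus
    infinity. *)
Lemma mean_set_lub (g : C -> C) (M : R) : holo_disk g ->
  (forall r, 0 < r < 1 -> circ_mean p g r <= M) ->
  exists s, Lub_Rbar (mean_set g) = Finite s /\ 0 <= s <= M /\
    forall r, 0 < r < 1 -> circ_mean p g r <= s.
Proof.
intros Hg HM. destruct (Lub_Rbar_correct (mean_set g)) as [Hub Hlub].
assert (H1 : Rbar_le (Lub_Rbar (mean_set g)) M).
{ apply Hlub. intros y [r [Hr ->]]. now apply HM. }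
assert (H2 : forall r, 0 < r < 1 -> Rbar_le (circ_mean p g r) (Lub_Rbar (mean_set g))).
{ intros r Hr. apply Hub. now exists r. }
assert (Hh : 0 < / 2 < 1) by lra.
assert (H3 := H2 _ Hh). assert (H4 := circ_mean_ge_0 g _ Hg Hh).
destruct (Lub_Rbar (mean_set g)) as [s| |]; simpl in *; try tauto.
exists s. repeat split; trivial. lra.
Qed.

Lemma Hp_norm_le (g : C -> C) (A : R) : holo_disk g -> 0 <= A ->
  (forall r, 0 < r < 1 -> circ_mean p g r <= powr A p) -> Hp_norm p g <= A.
Proof.
intros Hg HA H. destruct (mean_set_lub g _ Hg H) as [s [E [Hs _]]].
unfold Hp_norm. fold (mean_set g). rewrite E. simpl.
rewrite <- (powr_powr A p (/ p)) by (trivial; field; lra).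
apply powr_le; trivial. left. now apply Rinv_0_lt_compat.
Qed.

Lemma Hp_norm_ge_0 (g : C -> C) : 0 <= Hp_norm p g.
Proof. apply powr_ge_0. Qed.

Lemma circ_mean_le_norm (g : C -> C) (r : R) : in_Hp p g -> 0 < r < 1 ->
  circ_mean p g r <= powr (Hp_norm p g) p.
Proof.
intros [Hg [M HM]] Hr. destruct (mean_set_lub g _ Hg HM) as [s [E [Hs H]]].
unfold Hp_norm. fold (mean_set g). rewrite E. simpl.
rewrite powr_powr; auto. lra. field; lra.
Qed.

(* For [A] above the norm, [x <= A + A (x / A)^p] replaces Jensen's inequality at the cost
   of a factor 2. *)
Lemma cmean_le_norm (g : C -> C) (r : R) : in_Hp p g -> 0 < r < 1 ->
  cmean (fun t => g (polar r t)) <= 2 * Hp_norm p g.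
Proof.
intros Hg Hr. apply le_epsilon. intros e He.
(* The extra e / 2 keeps A positive when the norm is 0, so that division by A^p is legitimate; the
   outcome A + A is then 2 times the norm plus e. *)
set (A := Hp_norm p g + e / 2).
assert (HN := Hp_norm_ge_0 g).
assert (HA : 0 < A) by (unfold A; lra).
assert (HAp := powr_gt_0 A p HA).
apply Rle_trans with (A + A / powr A p * powr A p).
2:{ replace (A / powr A p * powr A p) with A by (field; lra). unfold A; lra. }
apply (RInt_mean_le (fun t => Cmod (g (polar r t))) A (A / powr A p) (powr A p))
  with (v := fun t => powr (Cmod (g (polar r t))) p).
- intros t. apply continuous_Cmod. apply ccont_circle; trivial. apply Hg.
- apply continuous_powr_circle; trivial. apply Hg.
- left. now apply Rdiv_lt_0_compat.
- intros t. generalize (Cmod_ge_0 (g (polar r t))). generalize (Cmod (g (polar r t))).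
  intros x Hx. assert (Hxp := powr_ge_0 x p).
  assert (H0 : 0 <= A / powr A p * powr x p).
  { apply Rmult_le_pos; trivial. left. now apply Rdiv_lt_0_compat. }
  destruct (Rle_dec x A). lra.
  apply Rle_trans with (A / powr A p * powr x p). 2: lra.
  replace x with (A * (x / A)) at 2 by (field; lra).
  rewrite powr_mult. 2: lra. 2: apply Rdiv_le_0_compat; lra.
  replace (A / powr A p * (powr A p * powr (x / A) p)) with (A * powr (x / A) p) by (field; lra).
  apply Rle_trans with (A * (x / A)). right; field; lra.
  apply Rmult_le_compat_l. lra. apply powr_ge_self. lra.
  apply Rmult_le_reg_r with A; trivial. unfold Rdiv. rewrite Rmult_assoc, Rinv_l; lra.
- eapply Rle_trans. apply circ_mean_le_norm; trivial.
  apply powr_le. lra. unfold A. lra.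
Qed.

(** * Equality on the disk and membership in S^p *)

Lemma holo_disk_ext (f g : C -> C) :
  (forall z, in_disk z -> f z = g z) -> holo_disk f -> holo_disk g.
Proof.
intros E H z Hz. eapply cder_ex_derive. apply (cder_ext_disc f g 1); trivial.
now apply holo_cder.
Qed.

Lemma C_derive_ext_disk (f g : C -> C) : holo_disk f ->
  (forall z, in_disk z -> f z = g z) ->
  forall z, in_disk z -> C_derive f z = C_derive g z.
Proof.
intros Hf E z Hz. symmetry. apply cder_C_derive. apply (cder_ext_disc f g 1); trivial.
now apply holo_cder.
Qed.

Lemma circ_mean_ext (f g : C -> C) (r : R) :
  (forall z, in_disk z -> f z = g z) -> 0 < r < 1 -> circ_mean p f r = circ_mean p g r.
Proof.
intros E Hr. unfold circ_mean. f_equal. apply RInt_ext. intros t _.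
rewrite E; trivial. now apply in_disk_polar.
Qed.

Lemma in_Sp_ext (f g : C -> C) :
  (forall z, in_disk z -> f z = g z) -> in_Sp p f -> in_Sp p g.
Proof.
intros E [Hf [Hf' [M HM]]]. split. now apply (holo_disk_ext f).
assert (E' := C_derive_ext_disk f g Hf E).
split. now apply (holo_disk_ext (C_derive f)).
exists M. intros r Hr. rewrite <- (circ_mean_ext _ _ r E' Hr). auto.
Qed.

(** The image of an element of S^p under the operator, and the sum of the positive-order Neumann
    terms, have derivatives bounded on the whole disk; this is how they enter S^p. *)
Lemma in_Sp_of_bounded (h h' : C -> C) (m : R) :
  0 <= m ->
  (forall z, in_disk z -> cder h z (h' z)) -> holo_disk h' ->
  (forall z, in_disk z -> Cmod (h' z) <= m) ->
  in_Sp p h /\ Hp_norm p (C_derive h) <= m.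
Proof.
intros Hm0 Hh Hh' Hm.
assert (E : forall z, in_disk z -> h' z = C_derive h z).
{ intros z Hz. symmetry. now apply cder_C_derive, Hh. }
assert (Hd : holo_disk (C_derive h)) by now apply (holo_disk_ext h').
assert (B : forall r, 0 < r < 1 -> circ_mean p (C_derive h) r <= powr m p).
{ intros r Hr. apply circ_mean_bounded; trivial. intros z Hz. rewrite <- E; auto. }
split. 2: now apply Hp_norm_le.
split. intros z Hz. eapply cder_ex_derive. now apply Hh.
split; trivial. now exists (powr m p).
Qed.

(** The factor 4 stands in for Minkowski's inequality: by [powr_plus_le] the mean is at most 2^p
    (N^p + N^p), and 2 <= 2^p gives (4 N)^p. *)
Lemma Sp_lin (f g : C -> C) (c : C) : in_Sp p f -> in_Sp p g ->
  in_Sp p (fun w => c * f w + g w)%C /\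
  Hp_norm p (C_derive (fun w => c * f w + g w)%C) <=
    4 * (Cmod c * Hp_norm p (C_derive f) + Hp_norm p (C_derive g)).
Proof.
intros [Hf Hf'] [Hg Hg'].
assert (D : forall z, in_disk z ->
  cder (fun w => c * f w + g w)%C z (c * C_derive f z + C_derive g z)%C).
{ intros z Hz. apply cder_lin; now apply holo_cder. }
assert (Hs : holo_disk (fun z => c * C_derive f z + C_derive g z)%C).
{ intros z Hz. eapply cder_ex_derive. apply cder_lin; apply holo_cder; trivial.
  apply Hf'. apply Hg'. }
assert (E : forall z, in_disk z ->
  (c * C_derive f z + C_derive g z)%C = C_derive (fun w => c * f w + g w)%C z).
{ intros z Hz. symmetry. now apply cder_C_derive, D. }
assert (Hd := holo_disk_ext _ _ E Hs).
set (N := Cmod c * Hp_norm p (C_derive f) + Hp_norm p (C_derive g)).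
assert (Nf := Hp_norm_ge_0 (C_derive f)). assert (Ng := Hp_norm_ge_0 (C_derive g)).
assert (Hc := Cmod_ge_0 c).
assert (Nc : 0 <= Cmod c * Hp_norm p (C_derive f)) by now apply Rmult_le_pos.
assert (B : forall r, 0 < r < 1 ->
  circ_mean p (C_derive (fun w => c * f w + g w)%C) r <= powr (4 * N) p).
{ intros r Hr. rewrite <- (circ_mean_ext _ _ r E Hr).
  set (F := fun t => powr (Cmod (C_derive f (polar r t))) p).
  set (G := fun t => powr (Cmod (C_derive g (polar r t))) p).
  assert (cF : forall t, continuous F t) by (apply continuous_powr_circle; trivial; apply Hf').
  assert (cG : forall t, continuous G t) by (apply continuous_powr_circle; trivial; apply Hg').
  assert (mF := circ_mean_le_norm _ r Hf' Hr). assert (mG := circ_mean_le_norm _ r Hg' Hr).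
  assert (H2 := powr_ge_0 2 p).
  set (K := powr (Cmod c) p).
  assert (HK : 0 <= K) by apply powr_ge_0.
  assert (mFG : RInt (fun t => 0 + 1 * (K * F t + G t)) 0 (2 * PI) / (2 * PI) <= powr N p + powr N p).
  { assert (I : is_RInt (fun t => K * F t + G t) 0 (2 * PI) (K * RInt F 0 (2 * PI) + RInt G 0 (2 * PI))).
    { apply (is_RInt_plus (V := R_NormedModule) (fun t => K * F t) G).
      apply (is_RInt_scal (V := R_NormedModule) F).
      apply (RInt_correct (V := R_CompleteNormedModule)). now apply ex_RInt_cont.
      apply (RInt_correct (V := R_CompleteNormedModule)). now apply ex_RInt_cont. }
    assert (E1 : forall t, 0 + 1 * (K * F t + G t) = K * F t + G t) by (intros; ring).
    rewrite (RInt_ext _ _ _ _ (fun t _ => E1 t)).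
    rewrite (is_RInt_unique (V := R_CompleteNormedModule) _ _ _ _ I).
    replace ((K * RInt F 0 (2 * PI) + RInt G 0 (2 * PI)) / (2 * PI))
      with (K * circ_mean p (C_derive f) r + circ_mean p (C_derive g) r)
      by (unfold circ_mean; fold F; fold G; field; generalize PI_RGT_0; lra).
    apply Rplus_le_compat.
    - apply Rle_trans with (K * powr (Hp_norm p (C_derive f)) p). now apply Rmult_le_compat_l.
      unfold K. rewrite <- powr_mult by trivial. apply powr_le; unfold N; lra.
    - eapply Rle_trans; [apply mG|]. apply powr_le; unfold N; lra. }
  apply Rle_trans with (0 + powr 2 p * (powr N p + powr N p)).
  - apply (RInt_mean_le (fun t => powr (Cmod (c * C_derive f (polar r t) + C_derive g (polar r t))%C) p)
      0 (powr 2 p) (powr N p + powr N p)) with (v := fun t => 0 + 1 * (K * F t + G t)); trivial.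
    + now apply (continuous_powr_circle (fun z => c * C_derive f z + C_derive g z)%C).
    + intros t. apply (continuous_ext (fun t => K * F t + G t)).
      intros u. change (K * F u + G u = 0 + 1 * (K * F u + G u)). ring.
      apply (continuous_plus (V := R_NormedModule) (fun t => K * F t) G); auto.
      apply (continuous_scal_r (K := R_AbsRing) (V := R_NormedModule) K F); auto.
    + intros t. unfold F, G, K. rewrite !Rplus_0_l, Rmult_1_l, <- powr_mult by apply Cmod_ge_0.
      eapply Rle_trans. 2: apply powr_plus_le; try lra; try apply Cmod_ge_0.
      * rewrite <- Cmod_mult. apply powr_le. lra. split. apply Cmod_ge_0. apply Cmod_triangle.
      * apply Rmult_le_pos; apply Cmod_ge_0.
  - rewrite (powr_mult 4) by (unfold N; lra).
    replace 4 with (2 * 2) by ring. rewrite powr_mult by lra.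
    rewrite Rplus_0_l, Rmult_assoc. apply Rmult_le_compat_l; trivial.
    replace (powr N p + powr N p) with (2 * powr N p) by ring.
    apply Rmult_le_compat_r. apply powr_ge_0. apply powr_ge_self; lra. }
split.
- split. intros z Hz. eapply cder_ex_derive, D, Hz.
  split; trivial. eexists; apply B.
- apply Hp_norm_le; trivial. unfold N; lra.
Qed.

End Hardy.

(** * Series of complex functions *)

(** [Series] is total on real sequences, so the value is meaningful only together with a convergence
    condition such as [dominated]. *)
Definition csum (u : nat -> C) : C :=
  (Series (fun n => fst (u n)), Series (fun n => snd (u n))).

Definition dominated (u : nat -> C) : Prop :=
  exists b, ex_series b /\ forall n, Cmod (u n) <= b n.

Lemma dominated_ex (u : nat -> C) : dominated u ->
  ex_series (fun n => fst (u n)) /\ ex_series (fun n => snd (u n)).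
Proof.
intros [b [Hb H]]. split; apply (ex_series_le (V := R_CompleteNormedModule) _ b); trivial; intros n.
eapply Rle_trans; [apply fst_le_Cmod | apply H].
eapply Rle_trans; [apply snd_le_Cmod | apply H].
Qed.

Lemma csum_ext (u v : nat -> C) : (forall n, u n = v n) -> csum u = csum v.
Proof. intros E. unfold csum. f_equal; apply Series_ext; intros n; now rewrite E. Qed.

Lemma csum_lin (u v : nat -> C) (c : C) : dominated u -> dominated v ->
  csum (fun n => c * u n + v n)%C = (c * csum u + csum v)%C.
Proof.
intros Hu Hv. destruct (dominated_ex u Hu) as [u1 u2]. destruct (dominated_ex v Hv) as [v1 v2].
assert (S1 : forall k w, ex_series w -> ex_series (fun n => k * w n)).
{ intros k w Hw. now apply (ex_series_scal (V := R_NormedModule) k w). }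
unfold csum. apply injective_projections; simpl.
- rewrite Series_plus, Series_minus, !Series_scal_l; auto.
  apply (ex_series_minus (V := R_NormedModule)); auto.
- rewrite Series_plus, Series_plus, !Series_scal_l; auto.
  apply (ex_series_plus (V := R_NormedModule)); auto.
Qed.

Lemma dominated_lin (u v : nat -> C) (c : C) : dominated u -> dominated v ->
  dominated (fun n => c * u n + v n)%C.
Proof.
intros [b [Hb Hu]] [d [Hd Hv]]. exists (fun n => Cmod c * b n + d n). split.
- apply (ex_series_plus (V := R_NormedModule)); trivial.
  now apply (ex_series_scal (V := R_NormedModule)).
- intros n. eapply Rle_trans; [apply Cmod_triangle|]. rewrite Cmod_mult.
  apply Rplus_le_compat; trivial. apply Rmult_le_compat_l; trivial. apply Cmod_ge_0.
Qed.

Lemma csum_shift (u : nat -> C) : dominated u -> csum u = (u 0%nat + csum (fun n => u (S n)))%C.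
Proof.
intros Hu. destruct (dominated_ex u Hu) as [u1 u2].
apply injective_projections; simpl.
now rewrite (Series_incr_1 (fun n => fst (u n))).
now rewrite (Series_incr_1 (fun n => snd (u n))).
Qed.

Lemma dominated_shift (u : nat -> C) : dominated u -> dominated (fun n => u (S n)).
Proof.
intros [b [Hb H]]. exists (fun n => b (S n)). split; auto.
now apply (ex_series_incr_1 (V := R_NormedModule) b).
Qed.

(** Both identities for the inverse reduce to this cancellation. *)
Lemma csum_telescope (u : nat -> C) : dominated u ->
  csum (fun n => u n - u (S n))%C = u 0%nat.
Proof.
intros Hu.
rewrite (csum_ext _ (fun n => RtoC (-1) * u (S n) + u n)%C).
2: { intros n. apply injective_projections; simpl; ring. }
rewrite csum_lin; trivial. 2: now apply dominated_shift.
rewrite (csum_shift u Hu). apply injective_projections; simpl; ring.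
Qed.

(** The factor 2 comes from bounding real and imaginary parts separately by the same majorant. *)
Lemma csum_Cmod (u : nat -> C) (b : nat -> R) : ex_series b ->
  (forall n, Cmod (u n) <= b n) -> Cmod (csum u) <= 2 * Series b.
Proof.
intros Hb H.
assert (K : forall w : nat -> R, (forall n, Rabs (w n) <= b n) -> Rabs (Series w) <= Series b).
{ intros w Hw. eapply Rle_trans. apply Series_Rabs.
  - apply (ex_series_le (V := R_CompleteNormedModule) (fun n => Rabs (w n)) b); trivial.
    intros n. change (Rabs (Rabs (w n)) <= b n). now rewrite Rabs_Rabsolu.
  - apply Series_le; trivial. intros n. split; trivial. apply Rabs_pos. }
eapply Rle_trans; [apply Cmod_le_Rabs|]. unfold csum; simpl.
assert (H1 := K (fun n => fst (u n)) (fun n => Rle_trans _ _ _ (fst_le_Cmod _) (H n))).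
assert (H2 := K (fun n => snd (u n)) (fun n => Rle_trans _ _ _ (snd_le_Cmod _) (H n))).
lra.
Qed.

(** The remainders of the terms add up to at most 2 [Series b] |w - z|^2, which is again a quadratic
    remainder. *)
Lemma cder_csum (u v : nat -> C -> C) (b : nat -> R) (z : C) : ex_series b ->
  (forall n w, in_disk w -> Cmod (u n w) <= b n) ->
  (forall n w, in_disk w -> Cmod (v n w) <= b n) ->
  (forall n w, in_disk w ->
    Cmod (u n w - u n z - v n z * (w - z))%C <= b n * Cmod (w - z)%C ^ 2) ->
  in_disk z -> cder (fun w => csum (fun n => u n w)) z (csum (fun n => v n z)).
Proof.
intros Hb Hu Hv Ht Hz.
apply (cder_sq _ 1 (2 * Series b)); trivial. intros w Hw.
assert (du : forall w, in_disk w -> dominated (fun n => u n w)) by (intros y Hy; exists b; auto).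
assert (dv : dominated (fun n => v n z)) by (exists b; auto).
replace (csum (fun n => u n w) - csum (fun n => u n z) - csum (fun n => v n z) * (w - z))%C
  with (csum (fun n => - (w - z) * v n z + (RtoC (-1) * u n z + u n w))%C).
- rewrite Rmult_assoc, (Rmult_comm (Series b)), <- Series_scal_l.
  apply csum_Cmod. now apply (ex_series_scal (V := R_NormedModule)).
  intros n. rewrite Rmult_comm. eapply Rle_trans; [|now apply Ht].
  right. f_equal. apply injective_projections; simpl; ring.
- rewrite (csum_lin (fun n => v n z) (fun n => RtoC (-1) * u n z + u n w)%C); auto.
  2: now apply dominated_lin; auto.
  rewrite csum_lin; auto. apply injective_projections; simpl; ring.
Qed.

(** The ratio of consecutive terms tends to 0: geometric decay beats the linear factor. The 6 is the
    one in (n + 6)! = (n + 6) (n + 5)!, the factorial of the majorants. *)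
Lemma ex_series_super (x L : R) (g : nat -> R) : 0 < x < 1 -> 0 < L ->
  (forall n, 0 < g n) -> (forall n, g (S n) = L * x ^ n * (INR n + 6) * g n) -> ex_series g.
Proof.
intros Hx HL Hg E.
assert (Hlim : is_lim_seq (fun n => / (INR n + 6)) 0).
{ assert (H : is_lim_seq (fun n => INR n + 6) p_infty).
  { apply (is_lim_seq_plus _ _ p_infty 6); [apply is_lim_seq_INR | apply is_lim_seq_const | reflexivity]. }
  apply (is_lim_seq_inv _ _ H). discriminate. }
(* It is the general term of a series with ratio x (n + 7) / (n + 6) = x + x / (n + 6), whose limit
   is x < 1. *)
assert (H0 : is_lim_seq (fun n => x ^ n * (INR n + 6)) 0).
{ apply ex_series_lim_0, ex_series_Rabs, (ex_series_DAlembert _ x). lra.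
  - intros n. apply Rgt_not_eq. apply Rmult_lt_0_compat. now apply pow_lt.
    generalize (pos_INR n); lra.
  - apply is_lim_seq_ext with (fun n => x + x * / (INR n + 6)).
    + intros n. assert (Hn := pos_INR n). assert (Hp := pow_lt x n (proj1 Hx)).
      rewrite S_INR. simpl. rewrite Rabs_right.
      * field. split; lra.
      * apply Rle_ge, Rdiv_le_0_compat. repeat apply Rmult_le_pos; lra. apply Rmult_lt_0_compat; lra.
      replace (Finite x) with (Finite (x + x * 0)) by (f_equal; ring).
      apply is_lim_seq_plus'. apply is_lim_seq_const.
      apply is_lim_seq_mult'; trivial. apply is_lim_seq_const. }
apply ex_series_Rabs, (ex_series_DAlembert _ 0). lra.
- intros n. apply Rgt_not_eq, Hg.
- apply is_lim_seq_ext with (fun n => L * (x ^ n * (INR n + 6))).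
  + intros n. assert (Hn := pos_INR n). assert (Hp := pow_lt x n (proj1 Hx)). assert (Hgn := Hg n).
    rewrite E, Rabs_right. field; lra.
    apply Rle_ge, Rdiv_le_0_compat; trivial. repeat apply Rmult_le_pos; lra.
  + replace (Finite 0) with (Finite (L * 0)) by (f_equal; ring).
    apply is_lim_seq_mult'; trivial. apply is_lim_seq_const.
Qed.

(** * Cauchy's formula for f and for f' *)

Lemma cauchy_formula_derive (f f' : C -> C) (r : R) (z : C) :
  0 < r < 1 -> (forall w, in_disk w -> cder f w (f' w)) ->
  (forall w, in_disk w -> continuous (T := C_UniformSpace) (U := C_UniformSpace) f' w) ->
  Cmod z < r ->
  cauchy_int r (fun t => f (polar r t)) 0 z = f z /\
  cauchy_int r (fun t => f (polar r t)) 1 z = f' z.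
Proof.
intros Hr Hf Hf' Hz.
assert (E : forall w, Cmod w < r -> cauchy_int r (fun t => f (polar r t)) 0 w = f w).
{ intros w Hw. now apply (cauchy_formula f f' 1). }
split. auto.
assert (Hd : holo_disk f) by (intros w Hw; eapply cder_ex_derive, Hf, Hw).
(* Differentiating the formula of order 0 in z yields the one of order 1. *)
rewrite <- (cder_C_derive f z (f' z)) by (apply Hf; unfold in_disk; lra).
symmetry. apply cder_C_derive, (cder_ext_disc _ f r z _ E Hz).
apply cder_cauchy_int; trivial. lra. now apply (ccont_circle f r).
Qed.

(* [f] is continuously differentiable because [f'] is differentiable, so Cauchy's formula for
   [f] makes [f'] continuously differentiable, and then it also holds for [f']. *)
Lemma cauchy_derive (f : C -> C) (r : R) (z : C) :
  holo_disk f -> holo_disk (C_derive f) -> 0 < r < 1 -> Cmod z < r ->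
  cauchy_int r (fun t => C_derive f (polar r t)) 0 z = C_derive f z.
Proof.
intros Hf Hg Hr Hz.
assert (Cg : forall w, in_disk w ->
  continuous (T := C_UniformSpace) (U := C_UniformSpace) (C_derive f) w).
{ intros w Hw. eapply cder_continuous, holo_cder; trivial. }
apply (cauchy_formula_derive (C_derive f) (C_derive (C_derive f)) r z Hr); trivial.
{ intros w Hw. now apply holo_cder. }
intros w Hw.
set (s := (1 + Cmod w) / 2). unfold in_disk in Hw. assert (Hw0 := Cmod_ge_0 w).
assert (Hs : 0 < s < 1) by (unfold s; lra).
assert (Hws : Cmod w < s) by (unfold s; lra).
set (F := fun t => f (polar s t)).
assert (HF : ccont F) by now apply ccont_circle.
assert (E1 : forall y, Cmod y < s -> cauchy_int s F 1 y = C_derive f y).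
{ intros y Hy. apply (cauchy_formula_derive f (C_derive f) s y); trivial.
  intros; now apply holo_cder. }
(* Near [w], f'' is the transform of order 2 of f; the transform of order 3 is its derivative, so
   f'' is continuous at [w]. *)
assert (E2 : forall y, Cmod y < s -> cauchy_int s F 2 y = C_derive (C_derive f) y).
{ intros y Hy. symmetry. apply cder_C_derive, (cder_ext_disc _ _ s y _ E1 Hy).
  apply cder_cauchy_int; trivial. lra. }
apply (cder_continuous _ _ (cauchy_int s F 3 w)).
apply (cder_ext_disc _ _ s w _ E2 Hws). apply cder_cauchy_int; trivial. lra.
Qed.

(** * Iterates of the operator *)

Section Affine.
Variables (p : R) (a b : C).
Hypotheses (Hp : 1 < p) (Ha : 0 < Cmod a) (Hab : Cmod a < 1 - Cmod b).

Definition aff (z : C) : C := (a * z + b)%C.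
Definition rho : R := Cmod a + Cmod b.
(** Halfway between [rho], which bounds the image of the disk, and 1: the circle lies inside the
    disk, at a fixed distance from every point where the transform is evaluated. [inv_gap] bounds
    the kernel there. *)
Definition rad : R := (1 + rho) / 2.
Definition inv_gap : R := / (rad - rho).
Definition affn (n : nat) (z : C) : C := Nat.iter n aff z.

Let Hb : 0 <= Cmod b. Proof. apply Cmod_ge_0. Qed.
Let Hrad : 0 < rad < 1. Proof. unfold rad, rho; lra. Qed.
Let Hrr : rho < rad. Proof. unfold rad, rho; lra. Qed.
(** Being at least 1, [inv_gap] may be raised to a larger power in any upper bound. *)
Let Hgap : 1 <= inv_gap.
Proof.
unfold inv_gap. rewrite <- Rinv_1. apply Rinv_le_contravar; unfold rad, rho; lra.
Qed.
Let Hrho : rho < 1. Proof. unfold rho; lra. Qed.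

Lemma Cmod_aff (z : C) : in_disk z -> Cmod (aff z) <= rho.
Proof.
intros Hz. unfold aff, rho. eapply Rle_trans; [apply Cmod_triangle|].
rewrite Cmod_mult. apply Rplus_le_compat_r. rewrite <- (Rmult_1_r (Cmod a)) at 2.
unfold in_disk in Hz. apply Rmult_le_compat_l; lra.
Qed.

Lemma in_disk_aff (z : C) : in_disk z -> in_disk (aff z).
Proof. intros Hz. apply Cmod_aff in Hz. unfold in_disk. lra. Qed.

Lemma Cmod_affn (n : nat) (z : C) : in_disk z -> Cmod (affn (S n) z) <= rho.
Proof.
intros Hz. unfold affn. simpl. apply Cmod_aff. induction n; trivial.
simpl. now apply in_disk_aff.
Qed.

Lemma affn_affine (n : nat) (z : C) : affn n z = (a ^ n * z + affn n 0)%C.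
Proof.
unfold affn. induction n; simpl. ring. rewrite IHn. unfold aff. ring.
Qed.

Lemma affn_aff (n : nat) (z : C) : affn n (aff z) = affn (S n) z.
Proof. unfold affn. symmetry. apply Nat.iter_succ_r. Qed.

(* [coef n = a^(n(n+1)/2)]. *)
Fixpoint coef (n : nat) : C :=
  match n with 0 => RtoC 1 | S m => (coef m * a ^ S m)%C end.

(* With [F] the values of [f'] on the circle of radius [rad], [iter_deriv F k n] is the [k]-th
   derivative of the [(n+1)]-st iterate of [Dphi aff] applied to [f]: the shift by one is there
   because only [n >= 1] iterates extend past the unit circle. *)
Definition iter_deriv (F : R -> C) (k n : nat) (z : C) : C :=
  (coef n * (a ^ S n) ^ k * cauchy_int rad F (n + k) (affn (S n) z))%C.

Lemma coef_pos (n : nat) : 0 < Cmod (coef n).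
Proof.
induction n; simpl. rewrite Cmod_1. lra.
rewrite Cmod_mult. apply Rmult_lt_0_compat; trivial.
rewrite Cmod_mult, Cmod_pow. apply Rmult_lt_0_compat; trivial. now apply pow_lt.
Qed.

Lemma affn_minus (n : nat) (z w : C) : (affn n w - affn n z)%C = (a ^ n * (w - z))%C.
Proof. rewrite (affn_affine n w), (affn_affine n z). ring. Qed.

(** Each differentiation of the composite with the affine map brings out a^(n+1) and raises the
    order of the transform by one. *)
Lemma cder_iter_deriv (F : R -> C) (k n : nat) (z : C) : ccont F -> in_disk z ->
  cder (iter_deriv F k n) z (iter_deriv F (S k) n z).
Proof.
intros HF Hz.
assert (Hn := Cmod_affn n z Hz).
assert (H : cder (cauchy_int rad F (n + k)) (affn (S n) z) (cauchy_int rad F (S (n + k)) (affn (S n) z))).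
{ apply cder_cauchy_int; trivial; lra. }
rewrite affn_affine in H. apply cder_affine in H.
assert (H1 := cder_lin _ _ (coef n * (a ^ S n) ^ k)%C z _ _ H (cder_const 0 z)).
rewrite <- affn_affine in H1.
replace (iter_deriv F (S k) n z) with (coef n * (a ^ S n) ^ k * (a ^ S n * cauchy_int rad F (S (n + k)) (affn (S n) z)) + 0)%C.
- refine (cder_ext_disc _ _ 1 z _ _ Hz H1). intros w _. unfold iter_deriv.
  rewrite (affn_affine (S n) w). ring.
- unfold iter_deriv. replace (n + S k)%nat with (S (n + k)) by lia.
  change ((a ^ S n) ^ S k)%C with (a ^ S n * (a ^ S n) ^ k)%C. ring.
Qed.

(* One sequence dominating the derivatives of order at most [2] and the second-order Taylor
   remainders of order at most [1], whence the generous [n + 5]. *)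
Definition beta (n : nat) : R := Cmod (coef n) * INR (fact (n + 5)) * inv_gap ^ (n + 5).

Lemma Cmod_pow_le_1 (n k : nat) : 0 <= Cmod ((a ^ n) ^ k)%C <= 1.
Proof.
split. apply Cmod_ge_0. rewrite !Cmod_pow. rewrite <- (pow1 k). apply pow_incr.
split. apply pow_le, Cmod_ge_0. rewrite <- (pow1 n). apply pow_incr. lra.
Qed.

Lemma fact_mono (m n : nat) : (m <= n)%nat -> INR (fact m) <= INR (fact n).
Proof. intros H. apply le_INR. now apply fact_le. Qed.

Lemma beta_pos (n : nat) : 0 < beta n.
Proof.
repeat apply Rmult_lt_0_compat. apply coef_pos. apply INR_fact_lt_0. apply pow_lt. lra.
Qed.

Section Bounds.
Variable F : R -> C.
Hypothesis HF : ccont F.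

Lemma cmean_ge_0 : 0 <= cmean F.
Proof.
assert (H : 0 < 2 * PI) by (generalize PI_RGT_0; lra).
apply Rdiv_le_0_compat; trivial. apply RInt_ge_0. lra.
apply ex_RInt_cont. intros; apply continuous_Cmod, HF. intros; apply Cmod_ge_0.
Qed.

(** The chain rule factors are bounded by 1; the decay in n is carried by [coef] alone. The order n
    + k and the exponent n + k + 1 stay below n + 5. *)
Lemma iter_deriv_bound (k n : nat) (z : C) : (k <= 2)%nat -> in_disk z ->
  Cmod (iter_deriv F k n z) <= beta n * cmean F.
Proof.
intros Hk Hz. unfold iter_deriv, beta. rewrite !Cmod_mult, !Rmult_assoc.
apply Rmult_le_compat_l. apply Cmod_ge_0.
assert (H1 := Cmod_pow_le_1 (S n) k). assert (H2 := cmean_ge_0).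
rewrite <- Rmult_assoc. match goal with |- _ <= ?x => rewrite <- (Rmult_1_l x) end.
rewrite Rmult_assoc.
apply Rmult_le_compat; try lra. apply Cmod_ge_0.
eapply Rle_trans. apply (cauchy_int_bound rad rho); trivial. lra. now apply Cmod_affn.
fold inv_gap. rewrite <- Rmult_assoc. apply Rmult_le_compat_r; trivial.
apply Rmult_le_compat. apply pos_INR. apply pow_le; lra. apply fact_mono; lia.
apply Rle_pow; trivial. lia.
Qed.

(** The remainder of the transform is taken between the images of z and w, whose distance is
    |a|^(n+1) |w - z| <= |w - z|. *)
Lemma iter_deriv_taylor (k n : nat) (z w : C) : (k <= 1)%nat -> in_disk z -> in_disk w ->
  Cmod (iter_deriv F k n w - iter_deriv F k n z - iter_deriv F (S k) n z * (w - z))%C <=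
  beta n * cmean F * Cmod (w - z)%C ^ 2.
Proof.
intros Hk Hz Hw.
assert (T := cauchy_int_taylor rad rho F (conj (proj1 Hrad) (Rlt_le _ _ (proj2 Hrad))) Hrr HF (n + k)
  _ _ (Cmod_affn n z Hz) (Cmod_affn n w Hw)).
replace (iter_deriv F k n w - iter_deriv F k n z - iter_deriv F (S k) n z * (w - z))%C with
  (coef n * (a ^ S n) ^ k * (cauchy_int rad F (n + k) (affn (S n) w) - cauchy_int rad F (n + k) (affn (S n) z)
   - cauchy_int rad F (S (n + k)) (affn (S n) z) * (affn (S n) w - affn (S n) z)))%C.
2:{ rewrite affn_minus. unfold iter_deriv. replace (n + S k)%nat with (S (n + k)) by lia.
  change ((a ^ S n) ^ S k)%C with (a ^ S n * (a ^ S n) ^ k)%C. ring. }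
rewrite (affn_minus (S n)) in T at 2.
rewrite !Cmod_mult in *. fold inv_gap in T. unfold beta. rewrite !Rmult_assoc.
apply Rmult_le_compat_l. apply Cmod_ge_0.
assert (H1 := Cmod_pow_le_1 (S n) k). assert (H2 := cmean_ge_0).
assert (H3 := Cmod_pow_le_1 (S n) 1).
replace ((a ^ S n) ^ 1)%C with (a ^ S n)%C in H3 by (simpl; ring).
match goal with |- _ <= ?x => rewrite <- (Rmult_1_l x) end.
apply Rmult_le_compat; try lra. apply Cmod_ge_0.
eapply Rle_trans; [apply T|].
assert (H0 := Cmod_ge_0 (w - z)%C).
assert (Hq : (Cmod (a ^ S n)%C * Cmod (w - z)%C) ^ 2 <= Cmod (w - z)%C ^ 2).
{ apply pow_incr. split. apply Rmult_le_pos; lra.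
  rewrite <- (Rmult_1_l (Cmod (w - z)%C)) at 2. apply Rmult_le_compat_r; lra. }
(* With m = n + k, m! (m + 1)^2 <= (m + 2)!, and m + 2 <= n + 3. *)
assert (Hf : INR (fact (n + k)) * INR (S (n + k)) ^ 2 <= INR (fact (n + 5))).
{ apply Rle_trans with (INR (fact (n + k + 2))).
  2: apply fact_mono; lia.
  replace (n + k + 2)%nat with (S (S (n + k))) by lia.
  rewrite !fact_simpl, !mult_INR.
  assert (h1 := pos_INR (fact (n + k))). assert (h2 := pos_INR (S (n + k))).
  replace (INR (fact (n + k)) * INR (S (n + k)) ^ 2)
    with (INR (S (n + k)) * (INR (S (n + k)) * INR (fact (n + k)))) by ring.
  apply Rmult_le_compat_r. now apply Rmult_le_pos. rewrite (S_INR (S (n + k))). lra. }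
apply Rle_trans with (INR (fact (n + 5)) * inv_gap ^ (n + 5) * (cmean F * Cmod (w - z)%C ^ 2)).
2: right; ring.
replace (INR (fact (n + k)) * (INR (S (n + k)) ^ 2 * inv_gap ^ (n + k + 3)) * cmean F *
  (Cmod (a ^ S n)%C * Cmod (w - z)%C) ^ 2) with
  ((INR (fact (n + k)) * INR (S (n + k)) ^ 2) * inv_gap ^ (n + k + 3) * (cmean F *
  (Cmod (a ^ S n)%C * Cmod (w - z)%C) ^ 2)) by ring.
apply Rmult_le_compat.
- apply Rmult_le_pos. apply Rmult_le_pos. apply pos_INR. apply pow_le, pos_INR. apply pow_le; lra.
- apply Rmult_le_pos; trivial. apply pow_le. apply Rmult_le_pos; lra.
- apply Rmult_le_compat; trivial.
  + apply Rmult_le_pos. apply pos_INR. apply pow_le, pos_INR.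
  + apply pow_le; lra.
  + apply Rle_pow; trivial. lia.
- now apply Rmult_le_compat_l.
Qed.

End Bounds.

(** The circle has radius [rad] < 1, so these are values of f' inside the disk, continuous in the
    angle. *)
Definition boundary (f : C -> C) (t : R) : C := C_derive f (polar rad t).

Lemma ccont_boundary (f : C -> C) : in_Sp p f -> ccont (boundary f).
Proof. intros Hf. apply (ccont_circle (C_derive f)); trivial. apply Hf. Qed.

Lemma cmean_boundary (f : C -> C) : in_Sp p f ->
  0 <= cmean (boundary f) <= 2 * Hp_norm p (C_derive f).
Proof.
intros Hf. split. apply cmean_ge_0. now apply ccont_boundary.
apply cmean_le_norm; trivial. apply Hf.
Qed.

Notation A := (Dphi aff).

(** The case of one iterate is Cauchy's formula for f'. One more application differentiates and then
    evaluates at [aff z]: the new factor a^(n+1) turns [coef n] into [coef (S n)], and the inner map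
    gains one iterate. *)
Lemma iter_Dphi (f : C -> C) (n : nat) (z : C) : in_Sp p f -> in_disk z ->
  Nat.iter (S n) A f z = iter_deriv (boundary f) 0 n z.
Proof.
intros Hf. revert z. induction n as [|n IH]; intros z Hz.
- unfold iter_deriv. simpl Nat.iter. unfold Dphi. change (affn 1 z) with (aff z).
  simpl coef. simpl (0 + 0)%nat. unfold boundary. rewrite cauchy_derive; trivial.
  + simpl. ring.
  + apply Hf.
  + apply Hf.
  + apply Cmod_aff in Hz. lra.
- change (C_derive (Nat.iter (S n) A f) (aff z) = iter_deriv (boundary f) 0 (S n) z).
  assert (E : cder (Nat.iter (S n) A f) (aff z) (iter_deriv (boundary f) 1 n (aff z))).
  { apply (cder_ext_disc (iter_deriv (boundary f) 0 n) _ 1).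
    - intros w Hw. symmetry. now apply IH.
    - now apply in_disk_aff.
    - apply cder_iter_deriv. now apply ccont_boundary. now apply in_disk_aff. }
  rewrite (cder_C_derive _ _ _ E). unfold iter_deriv. rewrite affn_aff.
  replace (n + 1)%nat with (S n + 0)%nat by lia. simpl coef. simpl. ring.
Qed.

Lemma bounded_Dphi : bounded_op_Sp p A.
Proof.
assert (K : forall f, in_Sp p f -> in_Sp p (A f) /\
  Hp_norm p (C_derive (A f)) <= beta 0 * cmean (boundary f)).
{ intros f Hf.
  assert (HF := ccont_boundary f Hf).
  apply (in_Sp_of_bounded p Hp (A f) (iter_deriv (boundary f) 1 0)).
  - apply Rmult_le_pos. left; apply beta_pos. now apply cmean_ge_0.
  - intros z Hz. apply (cder_ext_disc (iter_deriv (boundary f) 0 0) _ 1); trivial.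
    + intros w Hw. symmetry. now apply (iter_Dphi f 0).
    + now apply cder_iter_deriv.
  - intros z Hz. eapply cder_ex_derive. now apply cder_iter_deriv.
  - intros z Hz. apply iter_deriv_bound; trivial. lia. }
split; [|split; [|split]].
- intros f Hf. now apply K.
- intros f g c Hf Hg z Hz. unfold Dphi. apply cder_C_derive.
  apply cder_lin; apply holo_cder; try apply in_disk_aff; trivial. apply Hf. apply Hg.
- intros f g Hf _ E z Hz. unfold Dphi. apply C_derive_ext_disk; trivial. apply Hf.
  now apply in_disk_aff.
(* The value at 0 and the derivative cost 2 [beta 0] each, the 2 being that of [cmean_le_norm]. *)
- exists (4 * beta 0). intros f Hf. unfold Sp_norm.
  assert (B0 := beta_pos 0). assert (D := cmean_boundary f Hf).
  assert (H0 : in_disk 0) by (unfold in_disk; rewrite Cmod_0; lra).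
  assert (H1 : Cmod (A f 0) <= beta 0 * cmean (boundary f)).
  { change (A f 0) with (Nat.iter 1 A f 0). rewrite iter_Dphi; trivial.
    apply iter_deriv_bound; trivial. now apply ccont_boundary. lia. }
  assert (H2 := proj2 (K f Hf)).
  assert (H3 : beta 0 * cmean (boundary f) <= beta 0 * (2 * Hp_norm p (C_derive f))).
  { apply Rmult_le_compat_l; lra. }
  assert (H4 : 0 <= beta 0 * Cmod (f 0)) by (apply Rmult_le_pos; [lra | apply Cmod_ge_0]).
  lra.
Qed.

Lemma iter_in_Sp (f : C -> C) (n : nat) : in_Sp p f -> in_Sp p (Nat.iter n A f).
Proof. intros Hf. induction n; trivial. simpl. now apply bounded_Dphi. Qed.

(** An iterate at z depends on f only through the disk, since [aff] keeps the disk inside itself;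
    membership in S^p at each stage supplies the differentiability. *)
Lemma iter_ext (f g : C -> C) (n : nat) (z : C) : in_Sp p f -> in_Sp p g ->
  (forall w, in_disk w -> f w = g w) -> in_disk z -> Nat.iter n A f z = Nat.iter n A g z.
Proof.
intros Hf Hg E. revert z. induction n; intros z Hz. now apply E.
simpl. apply bounded_Dphi; trivial; now apply iter_in_Sp.
Qed.

Lemma iter_lin (f g : C -> C) (c : C) (n : nat) (z : C) : in_Sp p f -> in_Sp p g -> in_disk z ->
  Nat.iter n A (fun w => c * f w + g w)%C z = (c * Nat.iter n A f z + Nat.iter n A g z)%C.
Proof.
intros Hf Hg. revert z. induction n; intros z Hz. reflexivity.
simpl. destruct bounded_Dphi as [_ [L [X _]]].
(* The induction hypothesis is an equality on the disk only, so the functions are exchanged before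
   linearity is applied. *)
rewrite (X _ (fun w => c * Nat.iter n A f w + Nat.iter n A g w)%C); trivial.
- apply L; trivial; now apply iter_in_Sp.
- apply iter_in_Sp. now apply Sp_lin.
- apply Sp_lin; trivial; now apply iter_in_Sp.
Qed.

(** * The resolvent *)

Section Resolvent.
Variable lam : C.
Hypothesis Hlam : lam <> RtoC 0.

Definition ilam (n : nat) : C := ((/ lam) ^ n)%C.

Let Hl : 0 < Cmod lam. Proof. now apply Cmod_gt_0. Qed.

Definition gamma (n : nat) : R := Cmod (ilam (S n)) * beta n.

(** From n to n + 1 the majorant gains 1 / |lam|, |a|^(n+1) from [coef], n + 6 from the factorial
    and one factor [inv_gap]. *)
Lemma ex_series_gamma : ex_series gamma.
Proof.
assert (Hi : forall n, 0 < Cmod (ilam n)).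
{ intros n. unfold ilam. rewrite Cmod_pow, Cmod_inv by trivial. apply pow_lt.
  now apply Rinv_0_lt_compat. }
apply (ex_series_super (Cmod a) (/ Cmod lam * Cmod a * inv_gap)).
- lra.
- repeat apply Rmult_lt_0_compat; try lra. now apply Rinv_0_lt_compat.
- intros n. apply Rmult_lt_0_compat; trivial. apply beta_pos.
- intros n. unfold gamma, beta, ilam. simpl coef.
  replace (S n + 5)%nat with (S (n + 5)) by lia.
  rewrite fact_simpl, mult_INR, !Cmod_pow, !Cmod_mult, Cmod_pow, Cmod_inv by trivial.
  rewrite S_INR, plus_INR. simpl pow. replace (INR 5) with 5 by (simpl; ring). ring.
Qed.

Definition term (f : C -> C) (n : nat) (z : C) : C :=
  (ilam (S n) * Nat.iter (S n) A f z)%C.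

(** The terms of order at least 1 in (A - lam)^-1 = - sum of lam^(-n-1) A^n, with the index shifted
    by one. *)
Definition tail (f : C -> C) (z : C) : C :=
  csum (fun n => - / lam * term f n z)%C.

(* The Neumann series of the inverse of [Dphi aff - lam]; its zeroth term is split off because
   [f'] alone is not bounded on the disk. *)
Definition resolvent (f : C -> C) : C -> C := fun z => (- / lam * f z + tail f z)%C.

Lemma term_bound (f : C -> C) (n : nat) (z : C) : in_Sp p f -> in_disk z ->
  Cmod (term f n z) <= cmean (boundary f) * gamma n.
Proof.
intros Hf Hz. unfold term, gamma. rewrite iter_Dphi, Cmod_mult by trivial.
rewrite (Rmult_comm (cmean _)), Rmult_assoc. apply Rmult_le_compat_l. apply Cmod_ge_0.
apply iter_deriv_bound; trivial. now apply ccont_boundary. lia.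
Qed.

Lemma dominated_term (f : C -> C) (z : C) : in_Sp p f -> in_disk z ->
  dominated (fun n => term f n z).
Proof.
intros Hf Hz. exists (fun n => cmean (boundary f) * gamma n). split.
- apply (ex_series_scal (V := R_NormedModule)), ex_series_gamma.
- intros n. now apply term_bound.
Qed.

Lemma dominated_scal (u : nat -> C) (c : C) : dominated u -> dominated (fun n => c * u n)%C.
Proof.
intros [d [Hd H]]. exists (fun n => Cmod c * d n). split.
- now apply (ex_series_scal (V := R_NormedModule)).
- intros n. rewrite Cmod_mult. apply Rmult_le_compat_l; trivial. apply Cmod_ge_0.
Qed.

Definition weight (n : nat) : C := (- / lam * ilam (S n))%C.

(** The series of [tail] differentiated k times term by term. Order 1 is its derivative, order 2
    shows that this derivative is holomorphic. *)
Definition tail_deriv (k : nat) (f : C -> C) (z : C) : C :=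
  csum (fun n => weight n * iter_deriv (boundary f) k n z)%C.

Definition total : R := 2 * (/ Cmod lam * Series gamma).

(** Serves two kinds of bounds: y = 1 for sizes and y = |w - z|^2 for Taylor remainders. *)
Lemma weight_mult_le (n : nat) (x : C) (y m : R) : 0 <= m ->
  Cmod x <= beta n * m * y -> Cmod (weight n * x)%C <= / Cmod lam * m * gamma n * y.
Proof.
intros Hm H. unfold weight, gamma. rewrite !Cmod_mult, Cmod_opp, Cmod_inv by trivial.
apply Rle_trans with (/ Cmod lam * Cmod (ilam (S n)) * (beta n * m * y)).
- apply Rmult_le_compat_l; trivial. apply Rmult_le_pos. left; now apply Rinv_0_lt_compat.
  apply Cmod_ge_0.
- right; ring.
Qed.

Lemma tail_deriv_0 (f : C -> C) (z : C) : in_Sp p f -> in_disk z -> tail_deriv 0 f z = tail f z.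
Proof.
intros Hf Hz. apply csum_ext. intros n. unfold term. rewrite iter_Dphi by trivial.
unfold weight. ring.
Qed.

Lemma tail_deriv_bound (k : nat) (f : C -> C) (z : C) : (k <= 2)%nat -> in_Sp p f -> in_disk z ->
  Cmod (tail_deriv k f z) <= total * cmean (boundary f).
Proof.
intros Hk Hf Hz.
apply Rle_trans with (2 * Series (fun n => / Cmod lam * cmean (boundary f) * gamma n)).
- apply csum_Cmod. apply (ex_series_scal (V := R_NormedModule)), ex_series_gamma.
  intros n. rewrite <- (Rmult_1_r (_ * gamma n)). apply weight_mult_le. now apply cmean_boundary.
  rewrite Rmult_1_r. apply iter_deriv_bound; trivial. now apply ccont_boundary.
- rewrite Series_scal_l. unfold total. right; ring.
Qed.

Lemma cder_tail_deriv (k : nat) (f : C -> C) (z : C) : (k <= 1)%nat -> in_Sp p f -> in_disk z ->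
  cder (tail_deriv k f) z (tail_deriv (S k) f z).
Proof.
intros Hk Hf Hz.
assert (HF := ccont_boundary f Hf). assert (Hm := proj1 (cmean_boundary f Hf)).
apply (cder_csum (fun n w => weight n * iter_deriv (boundary f) k n w)%C
  (fun n w => weight n * iter_deriv (boundary f) (S k) n w)%C
  (fun n => / Cmod lam * cmean (boundary f) * gamma n)); trivial.
- apply (ex_series_scal (V := R_NormedModule)), ex_series_gamma.
- intros n w Hw. rewrite <- (Rmult_1_r (_ * gamma n)). apply weight_mult_le; trivial.
  rewrite Rmult_1_r. apply iter_deriv_bound; trivial. lia.
- intros n w Hw. rewrite <- (Rmult_1_r (_ * gamma n)). apply weight_mult_le; trivial.
  rewrite Rmult_1_r. apply iter_deriv_bound; trivial. lia.
- intros n w Hw.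
  replace (weight n * iter_deriv (boundary f) k n w - weight n * iter_deriv (boundary f) k n z -
    weight n * iter_deriv (boundary f) (S k) n z * (w - z))%C with
   (weight n * (iter_deriv (boundary f) k n w - iter_deriv (boundary f) k n z - iter_deriv (boundary f) (S k) n z * (w - z)))%C by ring.
  apply weight_mult_le; trivial. now apply iter_deriv_taylor.
Qed.

Lemma total_ge_0 : 0 <= total.
Proof.
unfold total. apply Rmult_le_pos. lra. apply Rmult_le_pos. left; now apply Rinv_0_lt_compat.
rewrite <- (Rmult_0_l (Series gamma)), <- Series_scal_l. apply Series_le.
- intros n. rewrite Rmult_0_l. split. lra. apply Rmult_le_pos. apply Cmod_ge_0. left; apply beta_pos.
- apply ex_series_gamma.
Qed.

Lemma cder_tail (f : C -> C) (z : C) : in_Sp p f -> in_disk z ->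
  cder (tail f) z (tail_deriv 1 f z).
Proof.
intros Hf Hz. apply (cder_ext_disc (tail_deriv 0 f) _ 1); trivial.
intros w Hw; now apply tail_deriv_0. apply cder_tail_deriv; trivial. lia.
Qed.

Lemma tail_Sp (f : C -> C) : in_Sp p f ->
  in_Sp p (tail f) /\ Hp_norm p (C_derive (tail f)) <= total * cmean (boundary f).
Proof.
intros Hf. apply (in_Sp_of_bounded p Hp (tail f) (tail_deriv 1 f)).
- apply Rmult_le_pos. apply total_ge_0. now apply cmean_boundary.
- intros z Hz. now apply cder_tail.
- intros z Hz. eapply cder_ex_derive. apply cder_tail_deriv; trivial.
- intros z Hz. apply tail_deriv_bound; trivial. lia.
Qed.

Lemma bounded_resolvent : bounded_op_Sp p resolvent.
Proof.
split; [|split; [|split]].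
- intros f Hf. apply (Sp_lin p Hp f (tail f)); trivial. now apply tail_Sp.
- intros f g c Hf Hg z Hz. unfold resolvent, tail.
  rewrite (csum_ext _ (fun n => c * (- / lam * term f n z) + - / lam * term g n z)%C).
  + rewrite csum_lin. ring.
    apply dominated_scal; now apply dominated_term.
    apply dominated_scal; now apply dominated_term.
  + intros n. unfold term. rewrite iter_lin by trivial. ring.
- intros f g Hf Hg E z Hz. unfold resolvent, tail. rewrite E by trivial. f_equal.
  apply csum_ext. intros n. unfold term. now rewrite (iter_ext f g).
- assert (Ht := total_ge_0).
  assert (Hi : 0 < / Cmod lam) by now apply Rinv_0_lt_compat.
  (* With N the norm of f', the derivative costs 4 N / |lam| + 8 [total] N by [Sp_lin], and the
     value at 0 costs |f(0)| / |lam| + 2 [total] N. *)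
  exists (4 * / Cmod lam + 10 * total). intros f Hf. unfold Sp_norm.
  assert (D := cmean_boundary f Hf).
  assert (H0 : in_disk 0) by (unfold in_disk; rewrite Cmod_0; lra).
  destruct (tail_Sp f Hf) as [T1 T2].
  assert (L := proj2 (Sp_lin p Hp f (tail f) (- / lam)%C Hf T1)).
  fold (resolvent f) in L.
  assert (B : Cmod (resolvent f 0) <= / Cmod lam * Cmod (f 0) + total * cmean (boundary f)).
  { unfold resolvent. eapply Rle_trans; [apply Cmod_triangle|].
    rewrite Cmod_mult, Cmod_opp, Cmod_inv by trivial. apply Rplus_le_compat_l.
    rewrite <- tail_deriv_0 by trivial. apply tail_deriv_bound; trivial. lia. }
  rewrite Cmod_opp, Cmod_inv in L by trivial.
  assert (H3 : total * cmean (boundary f) <= total * (2 * Hp_norm p (C_derive f))).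
  { apply Rmult_le_compat_l; lra. }
  assert (H4 : 0 <= total * Cmod (f 0)) by (apply Rmult_le_pos; [lra | apply Cmod_ge_0]).
  assert (H5 : 0 <= / Cmod lam * Cmod (f 0)) by (apply Rmult_le_pos; [lra | apply Cmod_ge_0]).
  assert (H6 := Hp_norm_ge_0 p (C_derive f)).
  assert (H7 : 0 <= / Cmod lam * Hp_norm p (C_derive f)) by (apply Rmult_le_pos; lra).
  assert (H8 : 0 <= total * Hp_norm p (C_derive f)) by (apply Rmult_le_pos; lra).
  change (fun w => (- / lam * f w + tail f w)%C) with (resolvent f) in L.
  lra.
Qed.

Lemma term_telescope (f : C -> C) (z : C) : in_Sp p f -> in_disk z ->
  csum (fun n => term f n z - term f (S n) z)%C = (/ lam * A f z)%C.
Proof.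
intros Hf Hz. rewrite (csum_telescope (fun n => term f n z)) by now apply dominated_term.
unfold term, ilam. simpl. ring.
Qed.

(** By linearity of the iterates, the n-th term of the tail at A f - lam f is [term f n] minus
    [term f (S n)]. These sum to A f / lam, which the split-off term f - A f / lam completes to
    f. *)
Lemma resolvent_left (f : C -> C) (z : C) : in_Sp p f -> in_disk z ->
  resolvent (fun w => A f w - lam * f w)%C z = f z.
Proof.
intros Hf Hz.
assert (HA : in_Sp p (A f)) by now apply bounded_Dphi.
assert (HL : in_Sp p (fun w => - lam * f w + A f w)%C) by now apply Sp_lin.
(* The spectrum is stated with a difference while [iter_lin] expects a combination c f + g; the two
   agree on the disk. *)
assert (E : forall w, in_disk w -> (- lam * f w + A f w)%C = (A f w - lam * f w)%C) by (intros; ring).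
assert (HM : in_Sp p (fun w => A f w - lam * f w)%C) by now apply (in_Sp_ext p _ _ E).
unfold resolvent, tail.
rewrite (csum_ext _ (fun n => term f n z - term f (S n) z)%C).
- rewrite term_telescope by trivial. field. trivial.
- intros n. unfold term.
  rewrite <- (iter_ext _ _ (S n) z HL HM E Hz), iter_lin by trivial.
  rewrite <- (Nat.iter_succ_r (S n) _ A f). unfold ilam.
  change ((/ lam) ^ S (S n))%C with (/ lam * (/ lam) ^ S n)%C.
  generalize (Nat.iter (S n) A f z) (Nat.iter (S (S n)) A f z) ((/ lam) ^ S n)%C.
  intros x y q. field. trivial.
Qed.

(** Here A is applied to the sum, so the series must be differentiated. Evaluated at [aff z], the
    differentiated n-th term is - [term f (S n) z], and the sum telescopes as before. *)
Lemma resolvent_right (f : C -> C) (z : C) : in_Sp p f -> in_disk z ->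
  (A (resolvent f) z - lam * resolvent f z)%C = f z.
Proof.
intros Hf Hz.
assert (Hz' := in_disk_aff z Hz).
assert (D : A (resolvent f) z = (- / lam * A f z + tail_deriv 1 f (aff z))%C).
{ apply cder_C_derive. apply cder_lin. apply holo_cder; trivial. apply Hf. now apply cder_tail. }
assert (E : tail_deriv 1 f (aff z) = csum (fun n => - term f (S n) z)%C).
{ apply csum_ext. intros n. unfold term. rewrite iter_Dphi by trivial. unfold weight, iter_deriv.
  rewrite affn_aff. replace (n + 1)%nat with (S n + 0)%nat by lia. unfold ilam. simpl. ring. }
assert (Y : dominated (fun n => term f n z)) by now apply dominated_term.
assert (Q : csum (fun n => term f n z - term f (S n) z)%C =
  (- lam * tail f z + tail_deriv 1 f (aff z))%C).
{ unfold tail. rewrite E, <- csum_lin.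
  - apply csum_ext. intros n. field. trivial.
  - now apply dominated_scal.
  - destruct (dominated_shift _ Y) as [d [Hd Hb']]. exists d. split; trivial.
    intros n. now rewrite Cmod_opp. }
rewrite term_telescope in Q by trivial. rewrite D. unfold resolvent.
replace (- / lam * A f z + tail_deriv 1 f (aff z) - lam * (- / lam * f z + tail f z))%C
  with (- / lam * A f z + lam * / lam * f z + (- lam * tail f z + tail_deriv 1 f (aff z)))%C by ring.
rewrite <- Q. field. trivial.
Qed.

End Resolvent.

(** * The point 0 of the spectrum *)

Lemma in_Sp_const (c : C) : in_Sp p (fun _ => c).
Proof.
apply (in_Sp_of_bounded p Hp (fun _ => c) (fun _ => RtoC 0) 0). lra.
intros z _. apply cder_const. intros z _. eapply cder_ex_derive, cder_const.
intros z _. rewrite Cmod_0. lra.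
Qed.

(** A left inverse would recover both constants 1 and 0 from the same image 0. The two images are
    distinct terms that agree pointwise, so the inverse's compatibility with equality on the disk is
    what identifies its values. *)
Lemma spectrum_0 : in_spectrum_Sp p A (RtoC 0).
Proof.
intros [T [[_ [_ [X _]]] HT]].
assert (Z : forall k w, in_disk w -> RtoC 0 = (A (fun _ => k) w - 0 * k)%C).
{ intros k w Hw. unfold Dphi. rewrite (cder_C_derive _ _ _ (cder_const k _)). ring. }
assert (H0 : in_disk 0) by (unfold in_disk; rewrite Cmod_0; lra).
assert (I : forall k, in_Sp p (fun w => A (fun _ => k) w - 0 * k)%C).
{ intros k. apply (in_Sp_ext p (fun _ => RtoC 0)). apply Z. apply in_Sp_const. }
assert (E : RtoC 1 = RtoC 0).
{ etransitivity; [symmetry; exact (proj1 (HT _ (in_Sp_const (RtoC 1)) _ H0))|].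
  etransitivity; [|exact (proj1 (HT _ (in_Sp_const (RtoC 0)) _ H0))].
  apply X; trivial. intros w Hw. now rewrite <- !Z by trivial. }
injection E. lra.
Qed.

End Affine.

Theorem theorem4p1 (p : R) (a b : C) :
  1 < p -> 0 < Cmod a -> Cmod a < 1 - Cmod b ->
  let phi := fun z : C => Cplus (Cmult a z) b in
  bounded_op_Sp p (Dphi phi) /\
  (forall lam : C, in_spectrum_Sp p (Dphi phi) lam <-> lam = RtoC 0).
Proof.
intros Hp Ha Hab phi. change phi with (aff a b). split.
- now apply bounded_Dphi.
- intros lam. split.
  + intros H. destruct (Ceq_dec lam (RtoC 0)) as [E | E]; trivial.
    exfalso. apply H. exists (resolvent a b lam). split. now apply bounded_resolvent.
    intros f Hf z Hz. split. now apply (resolvent_left p). now apply (resolvent_right p).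
  + intros ->. now apply spectrum_0.
Qed.
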